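(* Let $(P,\omega)$ be a finite-dimensional symplectic manifold with a free and proper Hamiltonian action of an Abelian Lie group $G$, with momentum map $J:P\to U=J(P)\subset\mathfrak g^*$, and let $\pi:P\to P/G$ be the projection. Let $\mathcal A$ be a principal connection one-form on the principal $G$-bundle $\pi:P\to P/G$, with horizontal distribution $\operatorname{hor}=\operatorname{Ker}\mathcal A$. Then: (i) for every regular value $\mu\in U$ of $J$, $\mathcal A$ induces a principal connection $\alpha_\mu$ on the Marsden–Weinstein bundle $J^{-1}(\mu)\to J^{-1}(\mu)/G_\mu=J^{-1}(\mu)/G$, whose horizontal space at $x\in J^{-1}(\mu)$ is $\operatorname{hor}_\mu(x)=\operatorname{hor}(x)\cap\operatorname{Ker}T_xJ$; (ii) in particular, the distribution $A$ on $P$ given by $A(x)=\operatorname{hor}(x)\cap\operatorname{Ker}T_xJ$ is a reconstruction connection on $P$; (iii) the connections on the symplectic stratification of $P/G$ corresponding to $A$ and to $\mathcal A$ coincide: $\hat A=\hat{\mathcal A}$, i.e. for all $y\in P/G$ and $x\in\pi^{-1}(y)$, $$T_x\pi\big(A(x)^\omega\big)=T_x\pi\big(\operatorname{hor}(x)^\omega\big).$$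
   Context: All manifolds are smooth. The action is Hamiltonian: it preserves $\omega$ and admits an $\operatorname{Ad}^*$-equivariant momentum map $J:P\to\mathfrak g^*$, so $\omega(\xi_P,\cdot)=d\langle J,\xi\rangle$ for $\xi\in\mathfrak g$, where $\xi_P$ is the infinitesimal generator. $P/G$ carries the quotient Poisson structure. $G_\mu$ is the stabilizer of $\mu$ under the coadjoint action (so $G_\mu=G$ for Abelian $G$). $W^\omega$ denotes the $\omega$-orthogonal complement of $W\subset T_xP$. A connection on $P\to P/G$ is a $\mathfrak g$-valued one-form $\mathcal A$ on $P$ that is $G$-equivariant and satisfies $\mathcal A(\xi_P)=\xi$ for all $\xi\in\mathfrak g$. A reconstruction connection is a distribution $A$ on $P$ that is $G$-invariant and satisfies $\operatorname{Ker}T_xJ=T_x(G_\mu\cdot x)\oplus A(x)$ for all $x\in P$, $\mu=J(x)$. A connection on the symplectic stratification of $P/G$ is a distribution $D$ on $P/G$ with $T(P/G)=E\oplus D$, where $E$ is the characteristic distribution (the distribution tangent to the symplectic leaves). For a $G$-invariant distribution $A$ on $P$, $\hat A=\pi_*(A^\omega)$ is the distribution on $P/G$ given by $\hat A(y)=T_x\pi(A(x)^\omega)$, $x\in\pi^{-1}(y)$. For the connection one-form $\mathcal A$, $\hat{\mathcal A}$ denotes $\pi_*(\operatorname{hor}^\omega)$. *)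

(* Defs.v *)
From mathcomp Require Import all_boot all_order all_algebra.
From mathcomp Require Import all_classical all_reals all_analysis.
Import numFieldNormedType.Exports.

Set Implicit Arguments.
Unset Strict Implicit.
Unset Printing Implicit Defensive.

Import Order.TTheory GRing.Theory Num.Theory.
Local Open Scope classical_set_scope.
Local Open Scope ring_scope.

(* Linear-algebra conventions: vectors are rows and linear maps act on the
   right, so "T_x f" is a matrix with (T_x f)(v) = v *m T_x f.  Subspaces are
   row spaces, compared and combined with the operations of %MS. *)

(** * Smoothness on open subsets of normed spaces *)

Fixpoint times_differentiable_on (R : realType) (V W : normedModType R)
    (r : nat) (U : set V) (f : V -> W) : Prop :=
  if r is s.+1 then
    (forall x, U x -> differentiable f x) /\
    (forall v : V, times_differentiable_on s U (fun x => 'D_v f x))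
  else True.

Definition smooth_on (R : realType) (V W : normedModType R)
    (U : set V) (f : V -> W) : Prop :=
  open U /\ forall r, times_differentiable_on r U f.

(** * Manifolds *)

Record chart (R : realType) (n : nat) (T : topologicalType) := Chart {
  chart_dom : set T;
  chart_fun :> T -> 'rV[R]_n;
  chart_inv : 'rV[R]_n -> T;
  _ : open chart_dom;
  _ : open (chart_fun @` chart_dom);
  _ : {within chart_dom, continuous chart_fun};
  _ : {within chart_fun @` chart_dom, continuous chart_inv};
  _ : forall x, chart_dom x -> chart_inv (chart_fun x) = x
}.

(* The atlas need not be maximal. [chart_at x] is a chosen chart around x;
   it is used below to identify the tangent space at x with R^n. *)
Record manifold (R : realType) (n : nat) := Manifold {
  mspace :> topologicalType;
  _ : hausdorff_space mspace;
  _ : @second_countable mspace;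
  atlas : set (chart R n mspace);
  _ : forall a b, atlas a -> atlas b ->
      smooth_on (a @` (chart_dom a `&` chart_dom b)) (b \o chart_inv a);
  chart_at : mspace -> chart R n mspace;
  _ : forall x, atlas (chart_at x);
  _ : forall x, chart_dom (chart_at x) x
}.

Section Calculus.
Variable R : realType.

(* Smoothness on an open set W of a map between manifolds. *)
Definition smooth_map_on m n (M : manifold R m) (N : manifold R n)
    (W : set M) (f : M -> N) : Prop :=
  [/\ open W, forall x, W x -> {for x, continuous f} &
    forall a b, atlas a -> atlas b ->
      smooth_on (a @` (chart_dom a `&` W `&` f @^-1` chart_dom b))
                (b \o f \o chart_inv a)].

Definition smooth_map m n (M : manifold R m) (N : manifold R n) (f : M -> N) :=
  smooth_map_on setT f.

(* Smoothness of a map from a product L x M, in the product charts. *)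
Definition smooth_map2 l m n (L : manifold R l) (M : manifold R m)
    (N : manifold R n) (f : L -> M -> N) : Prop :=
  continuous (fun z : L * M => f z.1 z.2) /\
  forall a b c, atlas a -> atlas b -> atlas c ->
    smooth_on
      [set row_mx (a z.1) (b z.2) | z in
        [set z : L * M |
          [/\ chart_dom a z.1, chart_dom b z.2 & chart_dom c (f z.1 z.2)]]]
      (fun p : 'rV[R]_(l + m) =>
        c (f (chart_inv a (lsubmx p)) (chart_inv b (rsubmx p)))).

(* The tangent space at x is R^n, read in the chart [chart_at x]; this is the
   tangent map T_x f in these coordinates. *)
Definition tmap m n (M : manifold R m) (N : manifold R n) (f : M -> N) (x : M)
    : 'M[R]_(m, n) :=
  jacobian (chart_at (f x) \o f \o chart_inv (chart_at x)) (chart_at x x).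

Section VectorValued.
Variables (m : nat) (M : manifold R m).

(* Smooth functions with values in a normed space. *)
Definition smooth_fun (W : normedModType R) (F : M -> W) : Prop :=
  forall a, atlas a -> smooth_on (a @` chart_dom a) (F \o chart_inv a).

Definition differential d (F : M -> 'rV[R]_d) (x : M) : 'M[R]_(m, d) :=
  jacobian (F \o chart_inv (chart_at x)) (chart_at x x).

(* Rows: the coordinate vectors d/da^i in T_x M, for a chart a around x. *)
Definition coord_frame (a : chart R m M) (x : M) : 'M[R]_m :=
  jacobian (chart_at x \o chart_inv a) (a x).

(* Components in the chart a of the vectors of T_x M. *)
Definition coord_comp (a : chart R m M) (x : M) : 'M[R]_m :=
  jacobian (a \o chart_inv (chart_at x)) (chart_at x x).

Definition smooth_one_form d (A : M -> 'M[R]_(m, d)) : Prop :=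
  forall a, atlas a -> smooth_on (a @` chart_dom a)
    (fun p => let x := chart_inv a p in coord_frame a x *m A x).

(* A bilinear form is given by its Gram matrix: w_x(u, v) = u w v^T. *)
Definition form (w : M -> 'M[R]_m) (x : M) (u v : 'rV[R]_m) : R :=
  (u *m w x *m v^T) 0 0.

Definition coord_form (w : M -> 'M[R]_m) (a : chart R m M) (p : 'rV[R]_m)
    : 'M[R]_m :=
  let x := chart_inv a p in coord_frame a x *m w x *m (coord_frame a x)^T.

(* The last condition is dw = 0 in coordinates. *)
Definition symplectic_form (w : M -> 'M[R]_m) : Prop :=
  [/\ forall x, (w x)^T = - w x,
      forall x, w x \in unitmx,
      forall a, atlas a -> smooth_on (a @` chart_dom a) (coord_form w a) &
      forall a p, atlas a -> (a @` chart_dom a) p -> forall i j l : 'I_m,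
        'D_('e_i) (fun r => coord_form w a r j l) p
        + 'D_('e_j) (fun r => coord_form w a r l i) p
        + 'D_('e_l) (fun r => coord_form w a r i j) p = 0 :> R].

(* A subspace A x of T_x M for each x, having locally a smooth frame; the
   rank may vary from one connected component to another. *)
Definition distribution (A : M -> 'M[R]_m) : Prop :=
  forall x, exists r, exists V : set 'rV[R]_m,
    exists F : 'rV[R]_m -> 'M[R]_(r, m),
    let a := chart_at x in
    [/\ V (a x), V `<=` a @` chart_dom a, smooth_on V F &
        forall p, V p ->
          row_free (F p) /\
          (A (chart_inv a p) *m coord_comp a (chart_inv a p) :=: F p)%MS].

(* W^w = {u | w(u, v) = 0 for all v in W} *)
Definition sympl_orth d (w : 'M[R]_m) (W : 'M[R]_(d, m)) : 'M[R]_m :=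
  kermx (w *m W^T).

End VectorValued.

Definition embedding m n (N : manifold R m) (M : manifold R n) (f : N -> M) :=
  [/\ smooth_map f, injective f, forall z, row_free (tmap f z) &
      forall U : set N, open U -> exists2 V : set M, open V & U = f @^-1` V].

Definition proper_map (S T : topologicalType) (f : S -> T) :=
  continuous f /\ forall K : set T, compact K -> compact (f @^-1` K).

End Calculus.

(** * Lie groups and actions *)

Record lie_group (R : realType) (k : nat) := LieGroup {
  lgspace :> manifold R k;
  lgmul : lgspace -> lgspace -> lgspace;
  lgone : lgspace;
  lginv : lgspace -> lgspace;
  _ : associative lgmul;
  _ : left_id lgone lgmul;
  _ : left_inverse lgone lginv lgmul;
  _ : smooth_map2 lgmul;
  _ : smooth_map lginv
}.

Record lie_action (R : realType) (k n : nat) (G : lie_group R k)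
    (M : manifold R n) := LieAction {
  act :> G -> M -> M;
  _ : forall x, act (lgone G) x = x;
  _ : forall g h x, act (lgmul g h) x = act g (act h x);
  _ : smooth_map2 act
}.

Section Actions.
Variables (R : realType) (k : nat) (G : lie_group R k).

(* The Lie algebra is g = T_e G = R^k, and g^* = R^k via the pairing <_,_>. *)
Definition pairing (mu xi : 'rV[R]_k) : R := (mu *m xi^T) 0 0.

Definition Ad (g : G) : 'M[R]_k :=
  tmap (fun h : G => lgmul (lgmul g h) (lginv g)) (lgone G).

(* <coAd g mu, xi> = <mu, Ad_{g^-1} xi> *)
Definition coAd (g : G) (mu : 'rV[R]_k) : 'rV[R]_k := mu *m (Ad (lginv g))^T.

Definition stabilizer (mu : 'rV[R]_k) : set G := [set g | coAd g mu = mu].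

(* The Lie algebra of the stabilizer G_mu, i.e. the xi in g whose
   infinitesimal coadjoint action annihilates mu. *)
Definition stabilizer_algebra (mu : 'rV[R]_k) : 'M[R]_k :=
  kermx (differential (fun g : G => coAd g mu) (lgone G)).

Section OneAction.
Variables (n : nat) (M : manifold R n) (a : lie_action G M).

(* The infinitesimal generators: xi_M(x) = xi *m infgen x. *)
Definition infgen (x : M) : 'M[R]_(k, n) := tmap (fun g => a g x) (lgone G).

Definition free_action := forall g x, a g x = x -> g = lgone G.

Definition proper_action :=
  proper_map (fun z : G * M => (a z.1 z.2, z.2)).

(* Ad^*-equivariant momentum map J for an action preserving w; the last
   condition is w(xi_M, v) = d<J, xi>(v). *)
Definition hamiltonian_action (w : M -> 'M[R]_n) (J : M -> 'rV[R]_k) : Prop :=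
  [/\ forall g x u v,
        form w (a g x) (u *m tmap (a g) x) (v *m tmap (a g) x) = form w x u v,
      smooth_fun J,
      forall g x, J (a g x) = coAd g (J x) &
      forall x (xi : 'rV[R]_k) (v : 'rV[R]_n),
        form w x (xi *m infgen x) v = pairing (v *m differential J x) xi].

Definition regular_value (J : M -> 'rV[R]_k) (mu : 'rV[R]_k) : Prop :=
  forall x, J x = mu -> row_full (differential J x).

(* pi is a locally trivial principal G-bundle; B is then the manifold M/G.
   The local trivialization over V is (v, g) |-> g . s v, with inverse
   x |-> (pi x, tau x). *)
Definition principal_bundle q (B : manifold R q) (pi : M -> B) : Prop :=
  [/\ free_action, smooth_map pi, forall y, exists x, pi x = y,
      forall x x', pi x = pi x' <-> exists g, x' = a g x &
      forall y, exists V : set B, exists s : B -> M, exists tau : M -> G,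
        [/\ V y, smooth_map_on V s, smooth_map_on (pi @^-1` V) tau,
            forall v, V v -> pi (s v) = v &
            forall x, V (pi x) -> a (tau x) (s (pi x)) = x]].

(* A g-valued one-form A, with A_x(v) = v *m A x. *)
Definition principal_connection (A : M -> 'M[R]_(n, k)) : Prop :=
  [/\ smooth_one_form A,
      forall g x (v : 'rV[R]_n),
        v *m tmap (a g) x *m A (a g x) = v *m A x *m Ad g &
      forall x (xi : 'rV[R]_k), xi *m infgen x *m A x = xi].

Definition invariant_distribution (A : M -> 'M[R]_n) : Prop :=
  distribution A /\ forall g x, (A x *m tmap (a g) x :=: A (a g x))%MS.

(* Ker T_x J = T_x(G_mu . x) (+) A x, with mu = J x *)
Definition reconstruction_connection (J : M -> 'rV[R]_k) (A : M -> 'M[R]_n) :=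
  invariant_distribution A /\
  forall x, let orb := stabilizer_algebra (J x) *m infgen x in
    (kermx (differential J x) :=: orb + A x)%MS /\ (orb :&: A x :=: (0 : 'M[R]_n))%MS.

End OneAction.

(* rho is the bundle J^-1(mu) -> J^-1(mu)/G, the submanifold J^-1(mu) of M
   being given by an embedding iota : N -> M, with the restricted action. *)
Definition level_set_bundle n d q (M : manifold R n) (a : lie_action G M)
    (J : M -> 'rV[R]_k) (mu : 'rV[R]_k) (N : manifold R d) (iota : N -> M)
    (aN : lie_action G N) (B : manifold R q) (rho : N -> B) : Prop :=
  [/\ embedding iota, range iota = J @^-1` [set mu],
      forall g z, iota (aN g z) = a g (iota z) & principal_bundle aN rho].

End Actions.

Arguments stabilizer {R k} G mu.

(** * The symplectic stratification of the quotient *)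

Section Stratification.
Variables (R : realType) (n q : nat) (M : manifold R n) (Q : manifold R q).

(* Poisson bivectors are matrices: {f, h} = df *m b *m dh^T on covectors.
   With X_f *m w = df and {f, h} = w(X_f, X_h), the bivector of w is the
   transpose of w^-1. *)
Definition symplectic_bivector (w : M -> 'M[R]_n) (x : M) : 'M[R]_n :=
  (invmx (w x))^T.

(* b is the quotient Poisson structure: pi is a Poisson map. *)
Definition quotient_poisson (w : M -> 'M[R]_n) (pi : M -> Q)
    (b : Q -> 'M[R]_q) : Prop :=
  forall x, b (pi x) = (tmap pi x)^T *m symplectic_bivector w x *m tmap pi x.

(* The characteristic distribution, spanned by the Hamiltonian vectors
   dh |-> {_, h}, is the row space of b^T. *)
Definition characteristic (b : Q -> 'M[R]_q) (y : Q) : 'M[R]_q := (b y)^T.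

(* T(M/G) = E (+) D *)
Definition stratification_connection (b : Q -> 'M[R]_q) (D : Q -> 'M[R]_q) :=
  distribution D /\
  forall y, (characteristic b y + D y :=: (1%:M : 'M[R]_q))%MS /\
            (characteristic b y :&: D y :=: (0 : 'M[R]_q))%MS.

(* D = pi_*(A^w) *)
Definition is_hat (w : M -> 'M[R]_n) (pi : M -> Q)
    (A : M -> 'M[R]_n) (D : Q -> 'M[R]_q) : Prop :=
  forall y x, pi x = y -> (D y :=: sympl_orth (w x) (A x) *m tmap pi x)%MS.

End Stratification.

(* Main.v *)
Require Import Defs.
From HB Require Import structures.
From mathcomp Require Import all_boot all_order all_algebra.
From mathcomp Require Import all_classical all_reals all_analysis.
Import numFieldNormedType.Exports.
Import Order.TTheory GRing.Theory Num.Theory.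
Local Open Scope classical_set_scope.
Local Open Scope ring_scope.

Set Implicit Arguments.
Unset Strict Implicit.

(** Everything is decided at one point x of P, once smoothness is dealt with.

    Pointwise, let X be the matrix whose rows span the tangent space of the
    orbit, C the connection form and J the differential of the momentum map.
    The hypotheses give X C = 1, X J = 0 (the group is Abelian, so the momentum
    map is constant on orbits) and X w = J^T. Every vector v decomposes as
    v C X + (v - v C X), which splits Ker J into the orbit directions and
    A = Ker C /\ Ker J: this is the reconstruction property. The complement of
    Ker C for w is the row space of H = C^T w^-1, and the complement of Ker J
    is the row space of X. Hence the complement of A is spanned by H and X;
    as T pi kills exactly the rows of X, A and hor have the same image
    H (T pi) in the quotient ([orth_cap_proj]). The characteristic distribution
    is the image of Ker J ([characteristic_proj]), and H J = -1 shows that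
    Ker J and H are complementary, a splitting which survives in the quotient
    because Ker (T pi) lies in Ker J ([momentum_hor_orth_split]). On a regular
    level set, the tangent space is Ker J, so the pulled back form has
    horizontal space A ([level_set_tangent]).

    That T pi is onto with kernel the orbit directions comes from the local
    trivializations: differentiating x = tau(x) . s(pi x) with the Leibniz rule
    shows that a vector killed by T pi is the derivative of the group factor
    ([bundle_submersion], [bundle_vertical]).

    Smoothness is checked in charts. A is the kernel of the smooth map [C | J],
    which has a left inverse at each point, so it has local frames polynomial
    in C and J ([kernel_distribution]). The rows of H (T pi), read along a local section
    of the bundle, are a local frame of the connection on the quotient
    ([hat_distribution]); since C, w and T pi are equivariant they do not
    depend on the section ([hat_act]). *)

(** * Smooth functions between normed spaces *)

Section SmoothFunctions.
Variable R : realType.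
Implicit Types V W : normedModType R.

Lemma near_eq_diff V W (f g : V -> W) (x : V) :
  (\forall y \near x, f y = g y) -> differentiable f x ->
  differentiable g x /\ 'd g x = 'd f x :> (V -> W).
Proof.
move=> fg df; have dfc : continuous ('d f x) by exact: diff_continuous.
have gE : g \o shift x = cst (g x) + 'd f x +o_ (0 : V) id.
  apply/eqaddoP => e e0.
  have /eqaddoP/(_ e e0) := diff_locally df.
  have fgx := nbhs_singleton fg.
  move: fg; rewrite [\forall y \near x, _](near_shift 0) subr0 => fg.
  apply: filterS2 fg => y /= fgy; rewrite -!/(_ + _).
  by rewrite /GRing.add /= /GRing.opp /= /GRing.add /= -fgy -fgx.
have dgE := diff_unique dfc gE; split=> //.
by apply/diff_locallyP; rewrite dgE.
Qed.

Local Notation td := times_differentiable_on.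

Lemma times_differentiable_onS V W r (U : set V) (f : V -> W) :
  td r.+1 U f -> td r U f.
Proof.
elim: r f => // r IH f [df dDf]; split=> // v; exact/IH/dDf.
Qed.

Lemma times_differentiable_on_sub V W r (U U' : set V) (f : V -> W) :
  U' `<=` U -> td r U f -> td r U' f.
Proof.
move=> sU; elim: r f => // r IH f [df dDf]; split=> [x /sU/df//|v]; exact/IH/dDf.
Qed.

Lemma times_differentiable_on_eq V W r (U : set V) (f g : V -> W) :
  open U -> (forall x, U x -> f x = g x) -> td r U f -> td r U g.
Proof.
move=> oU; elim: r f g => // r IH f g fg [df dDf].
have nfg x : U x -> \forall y \near x, f y = g y.
  by move=> Ux; apply: filterS (open_nbhs_nbhs (conj oU Ux)).
split=> [x Ux|v]; first by case: (near_eq_diff (nfg x Ux) (df x Ux)).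
apply: IH (dDf v) => x Ux; exact/near_eq_derive/nfg.
Qed.

Lemma times_differentiable_on_cst V W r (U : set V) (c : W) : td r U (fun _ => c).
Proof.
elim: r c => // r IH c; split=> [x _|v]; first exact: differentiable_cst.
rewrite (_ : (fun x => _) = fun _ : V => 0 : W); first exact: IH.
by apply/funext => x; rewrite derive_cst.
Qed.

Lemma times_differentiable_onD V W r (U : set V) (f g : V -> W) :
  open U -> td r U f -> td r U g -> td r U (fun x => f x + g x).
Proof.
move=> oU; elim: r f g => // r IH f g [df dDf] [dg dDg].
split=> [x Ux|v]; first exact: differentiableD (df x Ux) (dg x Ux).
apply: (times_differentiable_on_eq oU _ (IH _ _ (dDf v) (dDg v))) => x Ux.
rewrite -(@deriveD _ _ _ f g)//; apply: diff_derivable; [exact: df|exact: dg].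
Qed.

Lemma times_differentiable_on_lin V W W' r (U : set V) (l : {linear W -> W'})
    (f : V -> W) :
  open U -> continuous l -> td r U f -> td r U (l \o f).
Proof.
move=> oU cl; elim: r f => // r IH f [df dDf].
have dl y : differentiable l y by exact: linear_differentiable.
split=> [x Ux|v]; first exact: differentiable_comp (df x Ux) (dl _).
apply: (times_differentiable_on_eq oU _ (IH _ (dDf v))) => x Ux.
have dfx := df x Ux.
rewrite [RHS]deriveE; last exact: differentiable_comp.
by rewrite diff_comp//= diff_lin//= -deriveE.
Qed.

Lemma times_differentiable_onM V r (U : set V) (f g : V -> R^o) :
  open U -> td r U f -> td r U g -> td r U (fun x => f x * g x : R^o).
Proof.
move=> oU; elim: r f g => // r IH f g fS gS.
have [[df dDf] [dg dDg]] := (fS, gS).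
split=> [x Ux|v]; first exact: differentiableM (df x Ux) (dg x Ux).
have H := times_differentiable_onD oU (IH _ _ (times_differentiable_onS fS) (dDg v))
  (IH _ _ (times_differentiable_onS gS) (dDf v)).
apply: (times_differentiable_on_eq oU _ H) => x Ux.
by rewrite -[RHS](_ : 'D_v (f * g) x = _)// deriveM//;
  apply: diff_derivable; [exact: df|exact: dg].
Qed.

Lemma times_differentiable_on_sum V W r (U : set V) I (s : seq I) (Pr : pred I)
    (f : I -> V -> W) :
  open U -> (forall i, td r U (f i)) -> td r U (fun x => \sum_(i <- s | Pr i) f i x).
Proof.
move=> oU fS; elim: s => [|i s IH].
  apply: times_differentiable_on_eq (times_differentiable_on_cst r U (0 : W)) => //.
  by move=> x _; rewrite big_nil.
case: (boolP (Pr i)) => Pi; last first.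
  by apply: times_differentiable_on_eq IH => // x _; rewrite big_cons (negbTE Pi).
apply: times_differentiable_on_eq (times_differentiable_onD oU (fS i) IH) => //.
by move=> x _; rewrite big_cons Pi.
Qed.

Lemma times_differentiable_on_coord V m n r (U : set V) (F : V -> 'M[R]_(m, n)) i j :
  open U -> td r U F -> td r U (fun x => F x i j : R^o).
Proof.
move=> oU; have clin : linear ((fun A => A i j) : 'M[R]_(m, n) -> R^o).
  by move=> c A B; rewrite !mxE.
pose c : {linear 'M[R]_(m, n) -> R^o} :=
  HB.pack ((fun A => A i j) : 'M[R]_(m, n) -> R^o) (GRing.isLinear.Build _ _ _ _ _ clin).
by apply: (@times_differentiable_on_lin _ _ _ _ _ c) => //; exact: coord_continuous.
Qed.

(** The matrix is the sum of its entries times constant matrices, so scalar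
    functions are enough. *)
Lemma times_differentiable_on_mx V m n r (U : set V) (F : V -> 'M[R]_(m, n)) :
  open U -> (forall i j, td r U (fun x => F x i j : R^o)) -> td r U F.
Proof.
move=> oU FS; have slin (A : 'M[R]_(m, n)) : linear (( *:%R ^~ A) : R^o -> 'M[R]_(m, n)).
  by move=> c y z; rewrite scalerDl scalerA.
pose sc (A : 'M[R]_(m, n)) : {linear R^o -> 'M[R]_(m, n)} :=
  HB.pack (( *:%R ^~ A) : R^o -> 'M[R]_(m, n)) (GRing.isLinear.Build _ _ _ _ _ (slin A)).
have H : td r U (fun x => \sum_i \sum_j F x i j *: delta_mx i j).
  do 2![apply: times_differentiable_on_sum => // ?].
  by apply: (@times_differentiable_on_lin _ _ _ _ _ (sc _)) => //; exact: scalel_continuous.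
by apply: times_differentiable_on_eq H => // x _; rewrite -matrix_sum_delta.
Qed.

(** The chain rule in coordinates: it writes the derivative of a composite as a
    sum of products of functions to which induction on the order applies. *)
Lemma derive_comp_row V W m (f : V -> 'rV[R]_m) (g : 'rV[R]_m -> W) v x :
  differentiable f x -> differentiable g (f x) ->
  'D_v (g \o f) x = \sum_i ('D_v f x) 0 i *: 'D_('e_i) g (f x).
Proof.
move=> df dg; rewrite deriveE; last exact: differentiable_comp.
rewrite diff_comp//= -(deriveE v df) [in LHS](row_sum_delta ('D_v f x)) linear_sum.
by apply: eq_bigr => i _; rewrite linearZ/= -(deriveE _ dg).
Qed.

Lemma times_differentiable_on_comp V m n p r (U : set V) (U' : set 'rV[R]_m)
    (f : V -> 'rV[R]_m) (g : 'rV[R]_m -> 'M[R]_(n, p)) :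
  open U -> open U' -> (forall x, U x -> U' (f x)) ->
  td r U f -> td r U' g -> td r U (g \o f).
Proof.
move=> oU oU' fU fS gS; apply: times_differentiable_on_mx => // i j.
have hS := times_differentiable_on_coord i j oU' gS.
rewrite -[X in td r U X]/((fun y => g y i j : R^o) \o f).
move: (fun y => g y i j : R^o) hS => h {gS}.
elim: r fS h => // r IH fS h hS; have [[df dDf] [dh dDh]] := (fS, hS).
split=> [x Ux|v]; first exact: differentiable_comp (df x Ux) (dh _ (fU x Ux)).
have H : td r U (fun x => \sum_l ('D_v f x) 0 l * 'D_('e_l) h (f x) : R^o).
  apply: times_differentiable_on_sum => // l; apply: times_differentiable_onM => //.
    exact: (times_differentiable_on_coord 0 l oU (dDf v)).
  exact: (IH (times_differentiable_onS fS) _ (dDh 'e_l)).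
apply: times_differentiable_on_eq H => // x Ux.
by rewrite derive_comp_row//; [exact: df|exact/dh/fU].
Qed.

(** A neighborhood is part of the definition: at a single point, iterated
    derivatives are not stable under products or composition, because [derive]
    takes arbitrary values where a function is not differentiable. *)
Definition smooth_at V W (x : V) (f : V -> W) :=
  exists U, [/\ open U, U x & forall r, td r U f].

Lemma smooth_on_at V W (U : set V) (f : V -> W) x :
  smooth_on U f -> U x -> smooth_at x f.
Proof. by move=> [oU fS] Ux; exists U; split=> // r; exact: fS. Qed.

Lemma smooth_at_on V W (U : set V) (f : V -> W) :
  open U -> (forall x, U x -> smooth_at x f) -> smooth_on U f.
Proof.
move=> oU fS; split=> // r.
have : forall x, U x -> exists U', [/\ open U', U' x & td r U' f].
  by move=> x /fS[U' [oU' U'x f']]; exists U'; split=> //; exact: f'.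
elim: r f {fS} => // r IH f fS; split=> [x /fS[U' [_ U'x [df _]]]|v]; first exact: df.
by apply: IH => x /fS[U' [oU' U'x [_ dDf]]]; exists U'; split=> //; exact: dDf.
Qed.

Lemma smooth_at_near V W (x : V) (f : V -> W) :
  smooth_at x f -> \forall y \near x, smooth_at y f.
Proof.
move=> [U [oU Ux fS]]; apply: filterS (open_nbhs_nbhs (conj oU Ux)) => y Uy.
by exists U; split=> // r; exact: fS.
Qed.

Lemma smooth_at_eq V W (x : V) (f g : V -> W) :
  (\forall y \near x, f y = g y) -> smooth_at x f -> smooth_at x g.
Proof.
have nbE : forall A, nbhs x A -> exists2 B : set V, open_nbhs x B & B `<=` A.
  by move=> A; rewrite nbhsE.
move=> /nbE[U1 [oU1 U1x] fg] [U [oU Ux fS]].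
have oI : open (U `&` U1) by exact: openI.
exists (U `&` U1); split=> // r; apply: times_differentiable_on_eq (_ : td r _ f) => //.
  by move=> y [_ /fg].
by apply: times_differentiable_on_sub (fS r) => y [].
Qed.

Lemma smooth_at_differentiable V W (x : V) (f : V -> W) :
  smooth_at x f -> differentiable f x.
Proof. by move=> [U [oU Ux /(_ 1%N)[/(_ x Ux)]]]. Qed.

Lemma smooth_at_continuous V W (x : V) (f : V -> W) :
  smooth_at x f -> {for x, continuous f}.
Proof. by move=> /smooth_at_differentiable/differentiable_continuous. Qed.

Lemma smooth_at_derive V W (x : V) (f : V -> W) v :
  smooth_at x f -> smooth_at x (fun y => 'D_v f y).
Proof.
by move=> [U [oU Ux fS]]; exists U; split=> // r; have [_] := fS r.+1; exact.
Qed.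

Lemma smooth_at_cst V W (x : V) (c : W) : smooth_at x (fun _ => c).
Proof.
by exists setT; split=> // [|r]; [exact: openT|exact: times_differentiable_on_cst].
Qed.

Lemma smooth_at2 V W W' W'' (x : V) (f : V -> W) (g : V -> W') (h : V -> W'') :
  (forall r U, open U -> td r U f -> td r U g -> td r U h) ->
  smooth_at x f -> smooth_at x g -> smooth_at x h.
Proof.
move=> H [U [oU Ux fS]] [U' [oU' U'x gS]].
have oI : open (U `&` U') by exact: openI.
exists (U `&` U'); split=> // r; apply: H => //.
  by apply: times_differentiable_on_sub (fS r) => y [].
by apply: times_differentiable_on_sub (gS r) => y [].
Qed.

Lemma smooth_atD V W (x : V) (f g : V -> W) :
  smooth_at x f -> smooth_at x g -> smooth_at x (fun y => f y + g y).
Proof. by apply: smooth_at2 => r U; exact: times_differentiable_onD. Qed.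

Lemma smooth_atM V (x : V) (f g : V -> R^o) :
  smooth_at x f -> smooth_at x g -> smooth_at x (fun y => f y * g y : R^o).
Proof. by apply: smooth_at2 => r U; exact: times_differentiable_onM. Qed.

Lemma smooth_at_sum V W (x : V) I (s : seq I) (Pr : pred I) (f : I -> V -> W) :
  (forall i, smooth_at x (f i)) -> smooth_at x (fun y => \sum_(i <- s | Pr i) f i y).
Proof.
move=> fS; elim: s => [|i s IH].
  apply: smooth_at_eq (smooth_at_cst x (0 : W)).
  by near=> y; rewrite big_nil.
case: (boolP (Pr i)) => Pi; last first.
  by apply: smooth_at_eq IH; near=> y; rewrite big_cons (negbTE Pi).
by apply: smooth_at_eq (smooth_atD (fS i) IH); near=> y; rewrite big_cons Pi.
Unshelve. all: by end_near. Qed.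

Lemma smooth_at_prod V (x : V) I (s : seq I) (Pr : pred I) (f : I -> V -> R^o) :
  (forall i, smooth_at x (f i)) ->
  smooth_at x (fun y => \prod_(i <- s | Pr i) f i y : R^o).
Proof.
move=> fS; elim: s => [|i s IH].
  apply: smooth_at_eq (smooth_at_cst x (1 : R^o)).
  by near=> y; rewrite big_nil.
case: (boolP (Pr i)) => Pi; last first.
  by apply: smooth_at_eq IH; near=> y; rewrite big_cons (negbTE Pi).
by apply: smooth_at_eq (smooth_atM (fS i) IH); near=> y; rewrite big_cons Pi.
Unshelve. all: by end_near. Qed.

Lemma smooth_at_coord V m n (x : V) (F : V -> 'M[R]_(m, n)) i j :
  smooth_at x F -> smooth_at x (fun y => F y i j : R^o).
Proof.
by move=> [U [oU Ux FS]]; exists U; split=> // r; exact: times_differentiable_on_coord.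
Qed.

Lemma smooth_at_mx V m n (x : V) (F : V -> 'M[R]_(m, n)) :
  (forall i j, smooth_at x (fun y => F y i j : R^o)) -> smooth_at x F.
Proof.
move=> FS.
have {}FS i j : exists U : set V,
    [/\ open U, U x & forall r, td r U (fun y => F y i j : R^o)] by exact: FS.
pose U i j := projT1 (cid (FS i j)).
have : nbhs x [set y | forall ij : 'I_m * 'I_n, U ij.1 ij.2 y].
  apply: filter_forall => ij; apply: open_nbhs_nbhs; rewrite /U.
  by case: cid => ? [].
rewrite nbhsE => -[B [oB Bx] BU]; exists B; split=> // r.
apply: times_differentiable_on_mx => // i j.
apply: (@times_differentiable_on_sub _ _ _ (U i j)).
  by move=> y /BU/(_ (i, j)); exact.
by rewrite /U; case: cid => ? [_ _ ?] /=.
Qed.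

Lemma smooth_at_comp V m n p (x : V) (f : V -> 'rV[R]_m) (g : 'rV[R]_m -> 'M[R]_(n, p)) :
  smooth_at x f -> smooth_at (f x) g -> smooth_at x (g \o f).
Proof.
move=> fS [U' [oU' U'fx gS]]; have [U [oU Ux fSU]] := fS.
have := smooth_at_continuous fS; move=> /(_ U' (open_nbhs_nbhs (conj oU' U'fx))).
rewrite /= [nbhs x]nbhsE => -[U1 [oU1 U1x] fU1].
have oI : open (U `&` U1) by exact: openI.
exists (U `&` U1); split=> // r.
apply: (times_differentiable_on_comp oI oU' _ _ (gS r)) => [y [_ /fU1]//|].
by apply: times_differentiable_on_sub (fSU r) => y [].
Qed.

Lemma smooth_at_id m n (x : 'M[R]_(m, n)) : smooth_at x id.
Proof.
exists setT; split=> // [|[|r]]; first exact: openT.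
  by [].
split=> // v.
apply: times_differentiable_on_eq (times_differentiable_on_cst r _ v) => //.
  exact: openT.
by move=> y _; rewrite derive_id.
Qed.

Lemma smooth_at_mulmx V m n p (x : V) (F : V -> 'M[R]_(m, n)) (H : V -> 'M[R]_(n, p)) :
  smooth_at x F -> smooth_at x H -> smooth_at x (fun y => F y *m H y).
Proof.
move=> FS HS; apply: smooth_at_mx => i j.
have : smooth_at x (fun y => \sum_l F y i l * H y l j : R^o).
  by apply: smooth_at_sum => l; apply: smooth_atM; exact: smooth_at_coord.
by apply: smooth_at_eq; near=> y; rewrite mxE.
Unshelve. all: by end_near. Qed.

Lemma smooth_at_trmx V m n (x : V) (F : V -> 'M[R]_(m, n)) :
  smooth_at x F -> smooth_at x (fun y => (F y)^T).
Proof.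
move=> FS; apply: smooth_at_mx => i j.
by apply: smooth_at_eq (smooth_at_coord j i FS); near=> y; rewrite mxE.
Unshelve. all: by end_near. Qed.

Lemma smooth_at_row_mx V m n p (x : V) (F : V -> 'M[R]_(m, n)) (H : V -> 'M[R]_(m, p)) :
  smooth_at x F -> smooth_at x H -> smooth_at x (fun y => row_mx (F y) (H y)).
Proof.
move=> FS HS; apply: smooth_at_mx => i j; rewrite -(fintype.splitK j).
case: (fintype.split j) => l /=.
  by apply: smooth_at_eq (smooth_at_coord i l FS); near=> y; rewrite row_mxEl.
by apply: smooth_at_eq (smooth_at_coord i l HS); near=> y; rewrite row_mxEr.
Unshelve. all: by end_near. Qed.

Lemma smooth_at_det V n (x : V) (F : V -> 'M[R]_n) :
  smooth_at x F -> smooth_at x (fun y => \det (F y) : R^o).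
Proof.
move=> FS; rewrite /determinant; apply: smooth_at_sum => s.
apply: smooth_atM; first exact: smooth_at_cst.
by apply: smooth_at_prod => i; exact: smooth_at_coord.
Qed.

Lemma smooth_at_scalar_mx V n (x : V) (f : V -> R^o) :
  smooth_at x f -> smooth_at x (fun y => (f y)%:M : 'M[R]_n).
Proof.
move=> fS; apply: smooth_at_mx => i j.
have : smooth_at x (fun y => f y * (i == j)%:R : R^o).
  by apply: smooth_atM => //; exact: smooth_at_cst.
by apply: smooth_at_eq; apply: nearW => y; rewrite mxE mulr_natr.
Qed.

Lemma smooth_at_adj V n (x : V) (F : V -> 'M[R]_n) :
  smooth_at x F -> smooth_at x (fun y => \adj (F y)).
Proof.
move=> FS; apply: smooth_at_mx => i j.
have : smooth_at x (fun y => cofactor (F y) j i : R^o).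
  rewrite /cofactor; apply: smooth_atM; first exact: (smooth_at_cst x).
  apply: smooth_at_det; apply: smooth_at_mx => l l'.
  by apply: smooth_at_eq (smooth_at_coord (lift j l) (lift i l') FS); near=> y; rewrite !mxE.
by apply: smooth_at_eq; near=> y; rewrite mxE.
Unshelve. all: by end_near. Qed.

End SmoothFunctions.

(** * Jacobians *)

Section Jacobians.
Variable R : realType.

Lemma jac_subproof :
  {j : forall m n, ('rV[R]_m -> 'rV[R]_n) -> 'rV[R]_m -> 'M[R]_(m, n) |
    forall m n f x, j m n f x = jacobian f x}.
Proof. by exists (fun m n f x => jacobian f x). Qed.

(** An opaque copy of [jacobian]: comparing two jacobians by conversion would
    unfold the choice operator hidden in the differential. *)
Definition jac m n (f : 'rV[R]_m -> 'rV[R]_n) x : 'M[R]_(m, n) :=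
  sval jac_subproof m n f x.

Lemma jacE m n (f : 'rV[R]_m -> 'rV[R]_n) x : jac f x = jacobian f x.
Proof. exact: svalP jac_subproof m n f x. Qed.

Lemma mul_jac m n (f : 'rV[R]_m -> 'rV[R]_n) x v :
  differentiable f x -> v *m jac f x = 'D_v f x.
Proof. by move=> df; rewrite jacE deriveEjacobian. Qed.

Lemma jac_derive m n (f : 'rV[R]_m -> 'rV[R]_n) x :
  differentiable f x -> forall i j, jac f x i j = ('D_('e_i) f x) 0 j.
Proof. by move=> df i j; rewrite -mul_jac// -rowE [RHS]mxE. Qed.

Lemma smooth_at_jac m n (f : 'rV[R]_m -> 'rV[R]_n) x :
  smooth_at x f -> smooth_at x (jac f).
Proof.
move=> fS; apply: smooth_at_mx => i j.
have DS := smooth_at_coord 0 j (smooth_at_derive 'e_i fS).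
apply: smooth_at_eq DS; move: (smooth_at_near fS).
apply: filterS => y /smooth_at_differentiable df; exact: (esym (jac_derive df i j)).
Qed.

Lemma jac_near m n (f g : 'rV[R]_m -> 'rV[R]_n) x :
  (\forall y \near x, f y = g y) -> differentiable f x -> jac f x = jac g x.
Proof.
move=> fg df; have [dg _] := near_eq_diff fg df.
apply/row_matrixP => i; rewrite !rowE (mul_jac _ df) (mul_jac _ dg).
exact: near_eq_derive.
Qed.

Lemma jac_comp m n p (f : 'rV[R]_m -> 'rV[R]_n) (g : 'rV[R]_n -> 'rV[R]_p) x :
  differentiable f x -> differentiable g (f x) ->
  jac (g \o f) x = jac f x *m jac g (f x).
Proof.
move=> df dg; apply/row_matrixP => i; rewrite row_mul !rowE.
have dgf : differentiable (g \o f) x by exact: differentiable_comp.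
rewrite (mul_jac _ dgf) (mul_jac _ df) (mul_jac _ dg).
by rewrite (deriveE _ dgf) (deriveE _ df) (deriveE _ dg) diff_comp.
Qed.

Lemma jac_id m (x : 'rV[R]_m) : jac id x = 1%:M.
Proof.
by apply/row_matrixP => i; rewrite !rowE mul_jac// derive_id mulmx1.
Qed.

Lemma jac_cst m n (c : 'rV[R]_n) (x : 'rV[R]_m) : jac (fun _ => c) x = 0.
Proof.
have dc : differentiable ((fun _ => c) : 'rV[R]_m -> 'rV[R]_n) x.
  exact: differentiable_cst.
apply/row_matrixP => i; rewrite !rowE mulmx0 mul_jac//; exact: derive_cst.
Qed.

Lemma jac_coord m n (f : 'rV[R]_m -> 'rV[R]_n) x i j :
  smooth_at x f -> jac f x i j = 'D_('e_i) (fun y => f y 0 j : R^o) x.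
Proof.
move=> /smooth_at_differentiable df; rewrite (jac_derive df).
by rewrite (derive_mx (diff_derivable (v := 'e_i) df)) mxE.
Qed.

Lemma jac_row_mx l m n (f : 'rV[R]_l -> 'rV[R]_m) (g : 'rV[R]_l -> 'rV[R]_n) x :
  smooth_at x f -> smooth_at x g ->
  jac (fun y => row_mx (f y) (g y)) x = row_mx (jac f x) (jac g x).
Proof.
move=> fS gS; have fgS := smooth_at_row_mx fS gS.
apply/matrixP => i j; apply: etrans (jac_coord i j fgS) _.
rewrite -(fintype.splitK j); case: (fintype.split j) => h; rewrite [unsplit _]/=.
  rewrite row_mxEl; apply: etrans (esym (jac_coord i h fS)).
  have E : (fun y => row_mx (f y) (g y) 0 (lshift n h) : R^o) = (fun y => f y 0 h).
    by apply/funext => y; rewrite row_mxEl.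
  exact: (congr1 (fun F => 'D_('e_i) F x) E).
rewrite row_mxEr; apply: etrans (esym (jac_coord i h gS)).
have E : (fun y => row_mx (f y) (g y) 0 (rshift m h) : R^o) = (fun y => g y 0 h).
  by apply/funext => y; rewrite row_mxEr.
exact: (congr1 (fun F => 'D_('e_i) F x) E).
Qed.

End Jacobians.

(** * Charts *)

Section Charts.
Variables (R : realType) (m : nat) (M : manifold R m).
Implicit Types (a b : chart R m M) (x y : M).

Lemma chart_dom_open a : open (chart_dom a).
Proof. by case: a. Qed.

Lemma chart_codom_open a : open (a @` chart_dom a).
Proof. by case: a. Qed.

Lemma chartK a x : chart_dom a x -> chart_inv a (a x) = x.
Proof. by case: a => /= ? ? ? ? ? ? ?; exact. Qed.

Lemma chart_dom_near a x : chart_dom a x -> \forall y \near x, chart_dom a y.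
Proof. by move=> ax; exact: (open_nbhs_nbhs (conj (@chart_dom_open a) ax)). Qed.

Lemma chart_codom_near a x :
  chart_dom a x -> \forall p \near a x, (a @` chart_dom a) p.
Proof.
move=> ax; apply: open_nbhs_nbhs; split; first exact: chart_codom_open.
by exists x.
Qed.

Lemma chart_continuous a x : chart_dom a x -> {for x, continuous a}.
Proof.
move=> ax; have : {within chart_dom a, continuous a} by case: (a).
rewrite (continuous_open_subspace _ (@chart_dom_open a)).
by apply; rewrite inE.
Qed.

Lemma chart_inv_continuous a x :
  chart_dom a x -> {for a x, continuous (chart_inv a)}.
Proof.
move=> ax.
have : {within a @` chart_dom a, continuous (chart_inv a)} by case: (a).
rewrite (continuous_open_subspace _ (@chart_codom_open a)).
by apply; rewrite inE; exists x.
Qed.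

Lemma near_chart_inv a x (Pr : M -> Prop) : chart_dom a x ->
  (\forall y \near x, Pr y) -> \forall p \near a x, Pr (chart_inv a p).
Proof.
move=> ax Px; apply: (chart_inv_continuous ax); rewrite /= chartK//.
Qed.

Lemma near_chart a x (Pr : 'rV[R]_m -> Prop) : chart_dom a x ->
  (\forall p \near a x, Pr p) -> \forall y \near x, Pr (a y).
Proof. by move=> ax Px; exact: (chart_continuous ax). Qed.

Lemma chart_invK_near a x : chart_dom a x ->
  \forall p \near a x, a (chart_inv a p) = p.
Proof.
by move=> ax; apply: filterS (chart_codom_near ax) => p [y ay <-]; rewrite chartK.
Qed.

Lemma chart_at_atlas x : atlas (chart_at x).
Proof. by case: M x. Qed.

Lemma chart_at_dom x : chart_dom (chart_at x) x.
Proof. by case: M x. Qed.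

Lemma transition_smooth a b x : atlas a -> atlas b ->
  chart_dom a x -> chart_dom b x -> smooth_at (a x) (b \o chart_inv a).
Proof.
move=> aA bA ax bx.
have tS : smooth_on (a @` (chart_dom a `&` chart_dom b)) (b \o chart_inv a).
  by case: M a b x aA bA ax bx => /= T _ _ A tS ca _ _ a b x aA bA _ _; exact: tS.
by apply: smooth_on_at tS _; exists x.
Qed.

End Charts.

#[global] Hint Resolve chart_at_atlas chart_at_dom : core.

(** * Smooth maps from a manifold to a normed space *)

Section VectorValuedMaps.
Variables (R : realType) (m : nat) (M : manifold R m).
Implicit Types (a b : chart R m M) (x y : M) (W : normedModType R).

Definition vsmooth_at W (F : M -> W) x :=
  forall a, atlas a -> chart_dom a x -> smooth_at (a x) (F \o chart_inv a).

(** Transition maps are smooth, so one chart decides. *)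
Lemma vsmooth_at_chart p q (F : M -> 'M[R]_(p, q)) a x :
  atlas a -> chart_dom a x -> smooth_at (a x) (F \o chart_inv a) ->
  vsmooth_at F x.
Proof.
move=> aA ax FS b bA bx.
have tS := transition_smooth bA aA bx ax.
have bax : (a \o chart_inv b) (b x) = a x by rewrite /= chartK.
rewrite -bax in FS; apply: smooth_at_eq (smooth_at_comp tS FS).
have /(near_chart_inv bx) := chart_dom_near ax.
by apply: filterS => p' /= ap; rewrite chartK.
Qed.

Lemma vsmooth_at_near p q (F : M -> 'M[R]_(p, q)) x :
  vsmooth_at F x -> \forall y \near x, vsmooth_at F y.
Proof.
move=> /(_ (chart_at x) (chart_at_atlas x) (chart_at_dom x))/smooth_at_near.
move=> /(near_chart (chart_at_dom x)) FS.
apply: filterS2 FS (chart_dom_near (chart_at_dom x)) => y FS ay.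
exact: vsmooth_at_chart FS.
Qed.

Lemma vsmooth_at_eq W (F H : M -> W) x :
  (\forall y \near x, F y = H y) -> vsmooth_at F x -> vsmooth_at H x.
Proof.
move=> FH FS a aA ax; apply: smooth_at_eq (FS a aA ax).
exact: (near_chart_inv ax FH).
Qed.

Lemma smooth_fun_at W (F : M -> W) x : smooth_fun F -> vsmooth_at F x.
Proof. by move=> FS a aA ax; apply: smooth_on_at (FS a aA) _; exists x. Qed.

Lemma vsmooth_at_of_chart p q (F : 'rV[R]_m -> 'M[R]_(p, q)) a x :
  atlas a -> chart_dom a x -> smooth_at (a x) F -> vsmooth_at (F \o a) x.
Proof.
move=> aA ax FS; apply: (vsmooth_at_chart aA ax); apply: smooth_at_eq FS.
by apply: filterS (chart_invK_near ax) => p' /= ->.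
Qed.

Lemma chart_vsmooth_at a x : atlas a -> chart_dom a x -> vsmooth_at a x.
Proof. by move=> aA ax; apply: vsmooth_at_of_chart (smooth_at_id (a x)). Qed.

Lemma vsmooth_at_cst W (c : W) x : vsmooth_at (fun _ => c) x.
Proof. by move=> a aA ax; exact: smooth_at_cst. Qed.

Lemma vsmooth_at_comp p q r (F : M -> 'rV[R]_p) (H : 'rV[R]_p -> 'M[R]_(q, r)) x :
  vsmooth_at F x -> smooth_at (F x) H -> vsmooth_at (H \o F) x.
Proof.
move=> FS HS a aA ax; rewrite -[X in smooth_at _ X]/(H \o (F \o chart_inv a)).
by apply: smooth_at_comp; [exact: FS|rewrite /= chartK].
Qed.

Lemma vsmooth_at_mulmx p q r (F : M -> 'M[R]_(p, q)) (H : M -> 'M[R]_(q, r)) x :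
  vsmooth_at F x -> vsmooth_at H x -> vsmooth_at (fun y => F y *m H y) x.
Proof. move=> FS HS a aA ax; exact: smooth_at_mulmx (FS a aA ax) (HS a aA ax). Qed.

Lemma vsmooth_at_trmx p q (F : M -> 'M[R]_(p, q)) x :
  vsmooth_at F x -> vsmooth_at (fun y => (F y)^T) x.
Proof. move=> FS a aA ax; exact: smooth_at_trmx (FS a aA ax). Qed.

Lemma vsmooth_at_adj p (F : M -> 'M[R]_p) x :
  vsmooth_at F x -> vsmooth_at (fun y => \adj (F y)) x.
Proof. move=> FS a aA ax; exact: smooth_at_adj (FS a aA ax). Qed.

Lemma vsmooth_at_row_mx p q r (F : M -> 'M[R]_(p, q)) (H : M -> 'M[R]_(p, r)) x :
  vsmooth_at F x -> vsmooth_at H x -> vsmooth_at (fun y => row_mx (F y) (H y)) x.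
Proof. move=> FS HS a aA ax; exact: smooth_at_row_mx (FS a aA ax) (HS a aA ax). Qed.

Lemma vsmooth_at_continuous W (F : M -> W) x :
  vsmooth_at F x -> {for x, continuous F}.
Proof.
move=> /(_ (chart_at x) (chart_at_atlas x) (chart_at_dom x)) FS.
move: (smooth_at_continuous FS) => Fc U; rewrite -[in nbhs _ _](chartK (chart_at_dom x)).
move=> /(Fc U) /(near_chart (chart_at_dom x)) FU.
apply: filterS2 FU (chart_dom_near (chart_at_dom x)) => y /= + ay.
by rewrite chartK.
Qed.

(** This is [differential], written with the opaque Jacobian. *)
Definition vdiff d (F : M -> 'rV[R]_d) x : 'M[R]_(m, d) :=
  jac (F \o chart_inv (chart_at x)) (chart_at x x).

Lemma differentialE d (F : M -> 'rV[R]_d) x : differential F x = vdiff F x.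
Proof. by rewrite /vdiff jacE. Qed.

Lemma coord_compE a x : coord_comp a x = vdiff a x.
Proof. by rewrite /vdiff jacE. Qed.

Definition frame a x : 'M[R]_m := jac (chart_at x \o chart_inv a) (a x).

Lemma coord_frameE a x : coord_frame a x = frame a x.
Proof. by rewrite /frame jacE. Qed.

(** The chain rule for F = (F o c^-1) o c, with c the chosen chart around x. *)
Lemma frame_vdiff d (F : M -> 'rV[R]_d) a x :
  atlas a -> chart_dom a x -> vsmooth_at F x ->
  frame a x *m vdiff F x = jac (F \o chart_inv a) (a x).
Proof.
move=> aA ax FS; pose c := chart_at x.
have cx : chart_dom c x by exact: chart_at_dom.
have cA : atlas c by exact: chart_at_atlas.
have tS := smooth_at_differentiable (transition_smooth aA cA ax cx).
have dF := smooth_at_differentiable (FS _ cA cx).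
have cax : (c \o chart_inv a) (a x) = c x by rewrite /= chartK.
rewrite /frame /vdiff -/c -cax -jac_comp ?cax//; apply: esym; apply: jac_near.
  have /(near_chart_inv ax) := chart_dom_near cx.
  by apply: filterS => p /= cp; rewrite chartK.
exact: smooth_at_differentiable (FS _ aA ax).
Qed.

Lemma frame_vdiff_chart a x : atlas a -> chart_dom a x ->
  frame a x *m vdiff a x = 1%:M.
Proof.
move=> aA ax; rewrite frame_vdiff//; last exact: chart_vsmooth_at.
rewrite -(jac_id (a x)); apply: jac_near; first exact: chart_invK_near.
exact: smooth_at_differentiable (chart_vsmooth_at aA ax aA ax).
Qed.

Lemma vdiff_chart_frame a x : atlas a -> chart_dom a x ->
  vdiff a x *m frame a x = 1%:M.
Proof. by move=> aA ax; apply: mulmx1C; exact: frame_vdiff_chart. Qed.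

Lemma vdiff_near d (F H : M -> 'rV[R]_d) x :
  (\forall y \near x, F y = H y) -> vsmooth_at F x -> vdiff F x = vdiff H x.
Proof.
move=> FH FS; apply: jac_near; first exact: (near_chart_inv (chart_at_dom x) FH).
exact: smooth_at_differentiable (FS _ _ _).
Qed.

Lemma vdiff_cst d (c : 'rV[R]_d) x : vdiff (fun _ => c) x = 0.
Proof. exact: jac_cst. Qed.

Lemma vdiff_chart_at x : vdiff (chart_at x) x = 1%:M.
Proof.
have := frame_vdiff_chart (chart_at_atlas x) (chart_at_dom x).
by rewrite /frame /vdiff => /mulmx1_unit; rewrite -(jac_id (chart_at x x)) => _;
  apply: jac_near; [exact: chart_invK_near|
  exact: smooth_at_differentiable (chart_vsmooth_at _ _ _ _)].
Qed.

Lemma vdiff_comp p q (F : M -> 'rV[R]_p) (H : 'rV[R]_p -> 'rV[R]_q) x :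
  vsmooth_at F x -> smooth_at (F x) H ->
  vdiff (H \o F) x = vdiff F x *m jac H (F x).
Proof.
move=> FS HS; have cx := chart_at_dom x.
have FcS := FS _ (chart_at_atlas x) cx.
have Fx : (F \o chart_inv (chart_at x)) (chart_at x x) = F x by rewrite /= chartK.
rewrite /vdiff -[in RHS]Fx -jac_comp//; first exact: smooth_at_differentiable.
by rewrite Fx; exact: smooth_at_differentiable.
Qed.

(** The product is the Jacobian of F in the chart a. Neither factor need be
    smooth alone, since the chosen chart around y may jump with y. *)
Lemma vsmooth_frame_vdiff d (F : M -> 'rV[R]_d) a x :
  atlas a -> chart_dom a x -> vsmooth_at F x ->
  vsmooth_at (fun y => frame a y *m vdiff F y) x.
Proof.
move=> aA ax FS.
have : vsmooth_at (jac (F \o chart_inv a) \o a) x.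
  by apply: vsmooth_at_of_chart => //; apply: smooth_at_jac; exact: FS.
apply: vsmooth_at_eq; apply: filterS2 (vsmooth_at_near FS) (chart_dom_near ax).
by move=> y FyS ay; rewrite frame_vdiff.
Qed.

End VectorValuedMaps.
(** * Smooth maps between manifolds *)

Section ManifoldMaps.
Variable R : realType.

Definition msmooth_at m n (M : manifold R m) (N : manifold R n) (f : M -> N) x :=
  {for x, continuous f} /\
  forall b, atlas b -> chart_dom b (f x) -> vsmooth_at (b \o f) x.

Lemma msmooth_at_near m n (M : manifold R m) (N : manifold R n) (f : M -> N) x
    (Pr : N -> Prop) :
  msmooth_at f x -> (\forall y \near f x, Pr y) -> \forall y \near x, Pr (f y).
Proof. by move=> [fc _] Px; exact: fc. Qed.

Lemma smooth_map_on_at m n (M : manifold R m) (N : manifold R n) (f : M -> N) U x :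
  smooth_map_on U f -> U x -> msmooth_at f x.
Proof.
move=> [oU fc fS] Ux; split=> [|b bA bfx a aA ax]; first exact: fc.
by apply: smooth_on_at (fS a b aA bA) _; exists x.
Qed.

Lemma smooth_map_at m n (M : manifold R m) (N : manifold R n) (f : M -> N) x :
  smooth_map f -> msmooth_at f x.
Proof. by move=> /smooth_map_on_at; exact. Qed.

Lemma msmooth_at_id m (M : manifold R m) (x : M) : msmooth_at id x.
Proof. by split=> [//|b bA bx]; exact: chart_vsmooth_at. Qed.

Lemma msmooth_at_cst m n (M : manifold R m) (N : manifold R n) (y : N) (x : M) :
  msmooth_at (fun _ => y) x.
Proof.
split=> [|b bA bx]; [exact: cst_continuous|exact: (vsmooth_at_cst (b y))].
Qed.

Lemma vsmooth_at_pull m n p q (M : manifold R m) (N : manifold R n) (f : M -> N)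
    (F : N -> 'M[R]_(p, q)) x :
  msmooth_at f x -> vsmooth_at F (f x) -> vsmooth_at (F \o f) x.
Proof.
move=> fS FS; have bA := chart_at_atlas (f x); have bx := chart_at_dom (f x).
have : vsmooth_at ((F \o chart_inv (chart_at (f x))) \o (chart_at (f x) \o f)) x.
  exact: vsmooth_at_comp (fS.2 _ bA bx) (FS _ bA bx).
apply: vsmooth_at_eq; have := msmooth_at_near fS (chart_dom_near bx).
by apply: filterS => y /= byd; rewrite chartK.
Qed.

Lemma msmooth_at_comp m n p (M : manifold R m) (N : manifold R n) (L : manifold R p)
    (f : M -> N) (g : N -> L) x :
  msmooth_at f x -> msmooth_at g (f x) -> msmooth_at (g \o f) x.
Proof.
move=> fS gS; split.
  by apply: continuous_comp; [case: fS|case: gS].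
by move=> b bA bx; exact: (vsmooth_at_pull fS (gS.2 _ bA bx)).
Qed.

(** This is [tmap], written with the opaque Jacobian. *)
Definition tang m n (M : manifold R m) (N : manifold R n) (f : M -> N) x : 'M[R]_(m, n) :=
  vdiff (chart_at (f x) \o f) x.

Lemma tmapE m n (M : manifold R m) (N : manifold R n) (f : M -> N) x :
  tmap f x = tang f x.
Proof. by rewrite /tang /vdiff jacE. Qed.

(** Both factors are read in the chosen chart around f x, which cancels. *)
Lemma vdiff_pull m n d (M : manifold R m) (N : manifold R n) (f : M -> N)
    (F : N -> 'rV[R]_d) x :
  msmooth_at f x -> vsmooth_at F (f x) ->
  vdiff (F \o f) x = tang f x *m vdiff F (f x).
Proof.
move=> fS FS; have bA := chart_at_atlas (f x); have bx := chart_at_dom (f x).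
have fbS : vsmooth_at (chart_at (f x) \o f) x by case: fS => _; exact.
have FbS : smooth_at ((chart_at (f x) \o f) x) (F \o chart_inv (chart_at (f x))).
  exact: FS.
rewrite /tang [vdiff F _]/vdiff -[chart_at (f x) (f x)]/((chart_at (f x) \o f) x).
rewrite -vdiff_comp//; apply: vdiff_near; last exact: vsmooth_at_pull.
have := msmooth_at_near fS (chart_dom_near bx).
by apply: filterS => y /= byd; rewrite chartK.
Qed.

Lemma tang_comp m n p (M : manifold R m) (N : manifold R n) (L : manifold R p)
    (f : M -> N) (g : N -> L) x :
  msmooth_at f x -> msmooth_at g (f x) ->
  tang (g \o f) x = tang f x *m tang g (f x).
Proof.
move=> fS gS; rewrite {1}/tang [tang g _]/tang -vdiff_pull//.
by case: gS => _; apply.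
Qed.

Lemma tang_near m n (M : manifold R m) (N : manifold R n) (f g : M -> N) x :
  (\forall y \near x, f y = g y) -> msmooth_at f x -> tang f x = tang g x.
Proof.
move=> fg [_ fS]; rewrite /tang -(nbhs_singleton fg); apply: vdiff_near.
  by apply: filterS fg => y /= ->.
exact: fS.
Qed.

Lemma tang_id m (M : manifold R m) (x : M) : tang id x = 1%:M.
Proof. by rewrite /tang vdiff_chart_at. Qed.

Lemma tang_cst m n (M : manifold R m) (N : manifold R n) (y : N) (x : M) :
  tang (fun _ => y) x = 0.
Proof. rewrite /tang; exact: vdiff_cst. Qed.

Lemma tang_inverse m n (M : manifold R m) (N : manifold R n) (f : M -> N)
    (g : N -> M) x :
  msmooth_at f x -> msmooth_at g (f x) -> (\forall y \near x, g (f y) = y) ->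
  tang f x *m tang g (f x) = 1%:M.
Proof.
move=> fS gS gf; rewrite -tang_comp// -(tang_id x); apply: tang_near => //.
exact: msmooth_at_comp.
Qed.

Section TwoVariables.
Variables (l m n : nat) (L : manifold R l) (M : manifold R m) (N : manifold R n).
Variables (f : L -> M -> N) (fS : smooth_map2 f).
Variables (k : nat) (K : manifold R k) (u : K -> L) (v : K -> M) (z : K).
Hypotheses (uS : msmooth_at u z) (vS : msmooth_at v z).

Let local_form (a : chart R l L) (b : chart R m M) (c : chart R n N)
    (p : 'rV[R]_(l + m)) :=
  c (f (chart_inv a (lsubmx p)) (chart_inv b (rsubmx p))).

Lemma local_form_smooth a b c x y : atlas a -> atlas b -> atlas c ->
  chart_dom a x -> chart_dom b y -> chart_dom c (f x y) ->
  smooth_at (row_mx (a x) (b y)) (local_form a b c).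
Proof.
move=> aA bA cA ax byd cf; apply: smooth_on_at (fS.2 a b c aA bA cA) _.
by exists (x, y).
Qed.

Lemma local_form_near a b c :
  chart_dom a (u z) -> chart_dom b (v z) ->
  \forall y \near z, local_form a b c (row_mx (a (u y)) (b (v y))) = c (f (u y) (v y)).
Proof.
move=> au bv; have un := msmooth_at_near uS (chart_dom_near au).
have vn := msmooth_at_near vS (chart_dom_near bv).
by apply: filterS2 un vn => y /= auy bvy; rewrite /local_form row_mxKl row_mxKr !chartK.
Qed.

Lemma msmooth_at_map2 : msmooth_at (fun y => f (u y) (v y)) z.
Proof.
split.
  rewrite -[X in {for _, continuous X}]/((fun w => f w.1 w.2) \o (fun y => (u y, v y))).
  apply: continuous_comp; last exact: fS.1.
  by apply: cvg_pair; [exact: uS.1|exact: vS.1].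
move=> c cA cf; have [aA au] := (chart_at_atlas (u z), chart_at_dom (u z)).
have [bA bv] := (chart_at_atlas (v z), chart_at_dom (v z)).
apply: vsmooth_at_eq (local_form_near c au bv) _.
rewrite -[X in vsmooth_at X _]/(local_form (chart_at (u z)) (chart_at (v z)) c \o
  (fun y => row_mx (chart_at (u z) (u y)) (chart_at (v z) (v y)))).
apply: vsmooth_at_comp; last exact: local_form_smooth.
by apply: vsmooth_at_row_mx; [apply: uS.2|apply: vS.2].
Qed.

Lemma tang_local_form (a := chart_at (u z)) (b := chart_at (v z))
    (c := chart_at (f (u z) (v z))) :
  tang (fun y => f (u y) (v y)) z
  = row_mx (tang u z) (tang v z) *m jac (local_form a b c) (row_mx (a (u z)) (b (v z))).
Proof.
have [aA au] := (chart_at_atlas (u z), chart_at_dom (u z)).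
have [bA bv] := (chart_at_atlas (v z), chart_at_dom (v z)).
have lfS := local_form_smooth aA bA (chart_at_atlas _) au bv (chart_at_dom _).
have auS : vsmooth_at (a \o u) z := uS.2 _ aA au.
have bvS : vsmooth_at (b \o v) z := vS.2 _ bA bv.
have rS : vsmooth_at (fun y => row_mx (a (u y)) (b (v y))) z by exact: vsmooth_at_row_mx.
have -> : row_mx (tang u z) (tang v z) = vdiff (fun y => row_mx (a (u y)) (b (v y))) z.
  have zA := chart_at_atlas z; have zd := chart_at_dom z.
  rewrite /tang; apply: esym; exact: jac_row_mx (auS _ zA zd) (bvS _ zA zd).
rewrite /tang -(vdiff_comp rS lfS); apply: esym; apply: vdiff_near.
  exact: local_form_near.
exact: vsmooth_at_comp rS lfS.
Qed.

End TwoVariables.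

(** The Jacobian of the local form of f is the same in all instances of
    [tang_local_form] with the same values of u z and v z; taking u or v
    constant identifies its two blocks with the partial tangent maps. *)
Lemma tang_map2 l m n k (L : manifold R l) (M : manifold R m) (N : manifold R n)
    (K : manifold R k) (f : L -> M -> N) (u : K -> L) (v : K -> M) z :
  smooth_map2 f -> msmooth_at u z -> msmooth_at v z ->
  tang (fun y => f (u y) (v y)) z
  = tang u z *m tang (fun g => f g (v z)) (u z) + tang v z *m tang (f (u z)) (v z).
Proof.
move=> fS uS vS; rewrite tang_local_form//.
have := tang_local_form fS (msmooth_at_id (u z)) (msmooth_at_cst (v z) (u z)).
rewrite tang_id tang_cst => ->.
have := tang_local_form fS (msmooth_at_cst (u z) (v z)) (msmooth_at_id (v z)).
rewrite tang_id tang_cst [tang (fun _ => _) _](_ : _ = tang (f (u z)) (v z))// => ->.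
rewrite !mulmxA !mul_mx_row !mulmx1 !mulmx0 -mulmxDl add_row_mx addr0 add0r.
by [].
Qed.

End ManifoldMaps.

(** * Lie group actions *)

Section LieGroups.
Variables (R : realType) (k : nat) (G : lie_group R k).

Lemma lgmulA : associative (@lgmul R k G).
Proof. by case: G. Qed.

Lemma lgmul1 : left_id (lgone G) (@lgmul R k G).
Proof. by case: G. Qed.

Lemma lgmulV : left_inverse (lgone G) (@lginv R k G) (@lgmul R k G).
Proof. by case: G. Qed.

Lemma lgmul_smooth : smooth_map2 (@lgmul R k G).
Proof. by case: G. Qed.

Hypothesis G_abelian : commutative (@lgmul R k G).

Lemma Ad_abelian (g : G) : Ad g = 1%:M :> 'M[R]_k.
Proof.
rewrite /Ad [X in tmap X](_ : _ = id) ?tmapE ?tang_id//.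
by apply/funext => h; rewrite (G_abelian g) -lgmulA (G_abelian g) lgmulV G_abelian lgmul1.
Qed.

Lemma coAd_abelian (g : G) mu : coAd g mu = mu.
Proof. by rewrite /coAd Ad_abelian trmx1 mulmx1. Qed.

Lemma stabilizer_algebra_abelian mu : (stabilizer_algebra G mu :=: 1%:M)%MS.
Proof.
rewrite /stabilizer_algebra [X in differential X](_ : _ = fun _ => mu); last first.
  by apply/funext => g; rewrite coAd_abelian.
by rewrite differentialE vdiff_cst; apply: kermx0.
Qed.

End LieGroups.

(** This is [infgen], written with the opaque Jacobian. *)
Definition gen (R : realType) (k n : nat) (G : lie_group R k) (M : manifold R n)
    (a : lie_action G M) (x : M) : 'M[R]_(k, n) :=
  tang (fun g => a g x) (lgone G).

Lemma infgenE (R : realType) (k n : nat) (G : lie_group R k) (M : manifold R n)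
    (a : lie_action G M) (x : M) : infgen a x = gen a x.
Proof. exact: tmapE. Qed.

Section LieActions.
Variables (R : realType) (k n : nat) (G : lie_group R k) (M : manifold R n).
Variable a : lie_action G M.

Lemma act1 x : a (lgone G) x = x.
Proof. by case: (a). Qed.

Lemma actM g h x : a (lgmul g h) x = a g (a h x).
Proof. by case: (a). Qed.

Lemma act_smooth : smooth_map2 a.
Proof. by case: (a). Qed.

Lemma msmooth_act g x : msmooth_at (a g) x.
Proof.
exact (msmooth_at_map2 act_smooth (msmooth_at_cst g x) (msmooth_at_id x)).
Qed.

Lemma msmooth_orbit x g : msmooth_at (fun h => a h x) g.
Proof.
exact (msmooth_at_map2 act_smooth (msmooth_at_id g) (msmooth_at_cst x g)).
Qed.

Lemma tang_act_unit g x : tang (a g) x \in unitmx.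
Proof.
have := tang_inverse (msmooth_act g x) (msmooth_act (lginv g) (a g x)).
have gK : forall y, a (lginv g) (a g y) = y by move=> y; rewrite -actM lgmulV act1.
by move=> /(_ (nearW _ gK))/mulmx1_unit[].
Qed.

Lemma infgen_vdiff d (F : M -> 'rV[R]_d) x :
  vsmooth_at F x -> (forall g, F (a g x) = F x) -> gen a x *m vdiff F x = 0.
Proof.
move=> FS Fg; have FS1 : vsmooth_at F (a (lgone G) x) by rewrite act1.
have := vdiff_pull (msmooth_orbit x (lgone G)) FS1.
rewrite act1 => <-; rewrite [X in vdiff X](_ : _ = fun _ => F x) ?vdiff_cst//.
by apply/funext => g; rewrite /= Fg.
Qed.

Lemma infgen_tang m (N : manifold R m) (aN : lie_action G N) (f : M -> N) x :
  msmooth_at f x -> (forall g, f (a g x) = aN g (f x)) ->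
  gen a x *m tang f x = gen aN (f x).
Proof.
move=> fS fg; have fS1 : msmooth_at f (a (lgone G) x) by rewrite act1.
have := tang_comp (msmooth_orbit x (lgone G)) fS1.
rewrite act1 => <-; rewrite /gen; congr (tang _ _).
by apply/funext => g; rewrite /= fg.
Qed.

Section Bundle.
Variables (q : nat) (B : manifold R q) (pi : M -> B).
Hypothesis pi_bundle : principal_bundle a pi.

Lemma bundle_smooth x : msmooth_at pi x.
Proof. by case: pi_bundle => _ pS _ _ _; exact: smooth_map_at. Qed.

Lemma bundle_act g x : pi (a g x) = pi x.
Proof. by case: pi_bundle => _ _ _ piE _; apply/esym/piE; exists g. Qed.

Lemma bundle_tang_act g x : tang pi x = tang (a g) x *m tang pi (a g x).
Proof.
rewrite -tang_comp; [|exact: msmooth_act|exact: bundle_smooth].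
by congr (tang _ _); apply/funext => y; rewrite /= bundle_act.
Qed.

Lemma bundle_infgen x : gen a x *m tang pi x = 0.
Proof.
rewrite /tang; apply: infgen_vdiff => [|g]; last by rewrite /= bundle_act.
exact: (bundle_smooth x).2.
Qed.

(** A local section is a right inverse of pi near s(pi x); translating by the
    group moves it to x. *)
Lemma bundle_submersion x : row_full (tang pi x).
Proof.
case: pi_bundle => _ _ _ piE /(_ (pi x))[V [s [tau [Vx sS tS sV _]]]].
have /piE[g xE] : pi (s (pi x)) = pi x by exact: sV.
have oV : open V by case: sS.
have sS' := smooth_map_on_at sS Vx.
have := tang_near (g := id) _ (msmooth_at_comp sS' (bundle_smooth _)).
rewrite tang_id tang_comp//; last exact: bundle_smooth.
rewrite (bundle_tang_act g) -xE => sp; apply/row_fullP.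
exists (tang s (pi x) *m tang (a g) (s (pi x))); rewrite -mulmxA.
apply: sp; apply: filterS (open_nbhs_nbhs (conj oV Vx)) => y; exact: sV.
Qed.

(** In the local trivialization x = tau(x) . s(pi x), a vector killed by pi
    only moves the group factor, hence is tangent to the orbit. *)
Lemma bundle_vertical x : commutative (@lgmul R k G) ->
  (kermx (tang pi x) <= gen a x)%MS.
Proof.
move=> GC; case: pi_bundle => _ _ _ _ /(_ (pi x))[V [s [tau [Vx sS tS sV tE]]]].
have sS' := smooth_map_on_at sS Vx.
have spS := msmooth_at_comp (bundle_smooth x) sS'.
have tS' := smooth_map_on_at tS Vx.
have aS := msmooth_at_map2 act_smooth tS' spS.
have : tang (fun y => a (tau y) ((s \o pi) y)) x = 1%:M.
  rewrite -(tang_id x); apply: tang_near aS; have [oV _ _] := tS.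
  apply: filterS (open_nbhs_nbhs (conj oV Vx)) => y; exact: tE.
rewrite tang_map2//; last exact: act_smooth.
rewrite (tang_comp (bundle_smooth x) sS') -mulmxA.
set m := (s \o pi) x; set g := tau x; set Tg := tang (fun _ => _) g; set X := _ *m _ => E.
have TgE : Tg = tang (fun h => lgmul h (lginv g)) g *m gen a x.
  have gg : lgmul g (lginv g) = lgone G by rewrite GC lgmulV.
  have rS : msmooth_at (fun h : G => lgmul h (lginv g)) g.
    exact (msmooth_at_map2 (@lgmul_smooth R k G) (msmooth_at_id g) (msmooth_at_cst _ g)).
  rewrite /gen -[in RHS]gg -tang_comp//; last exact: msmooth_orbit.
  congr (tang _ _); apply/funext => h /=.
  by rewrite -(tE x Vx) -/m -/g -actM -lgmulA lgmulV GC lgmul1.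
rewrite -[kermx _]mulmx1 -E mulmxDr [X in _ + X]mulmxA mulmx_ker mul0mx addr0 /X TgE.
by rewrite !mulmxA submxMl.
Qed.

End Bundle.
End LieActions.

(** * Linear algebra at a point *)

Section LinearAlgebra.
Variable F : fieldType.

Lemma submx_tr_kermx m n p (B : 'M[F]_(n, p)) (C : 'M[F]_(n, m)) :
  kermx C *m B = 0 -> (B^T <= C^T)%MS.
Proof.
move=> CB; rewrite submxE -trmx_eq0 trmx_mul trmxK.
have /submxP[D ->] : ((cokermx C^T)^T <= kermx C)%MS.
  by apply/sub_kermxP/trmx_inj; rewrite trmx_mul trmxK mulmx_coker trmx0.
by rewrite -mulmxA CB mulmx0.
Qed.

Lemma cap_kermx m n p (B : 'M[F]_(n, p)) (C : 'M[F]_(n, m)) :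
  (kermx B :&: kermx C :=: kermx (row_mx B C))%MS.
Proof.
apply/eqmxP; apply/andP; split; apply/row_subP => i.
  have := row_sub i (kermx B :&: kermx C)%MS; rewrite sub_capmx !sub_kermx.
  by case/andP => /eqP eB /eqP eC; rewrite mul_mx_row eB eC row_mx0.
have := row_sub i (kermx (row_mx B C)); rewrite sub_capmx !sub_kermx mul_mx_row.
by rewrite -row_mx0 => /eqP/eq_row_mx[-> ->]; rewrite !eqxx.
Qed.

(** For T the inclusion of a submanifold with tangent space K, this locates in
    the ambient space the kernel of the pullback T *m C of a form C. *)
Lemma kermx_mul_eqmx d n k (T : 'M[F]_(d, n)) (C : 'M[F]_(n, k)) p (K : 'M[F]_(p, n)) :
  (T :=: K)%MS -> (kermx (T *m C) *m T :=: kermx C :&: K)%MS.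
Proof.
move=> TK; apply/eqmxP; apply/andP; split.
  rewrite sub_capmx -TK submxMl andbT; apply/sub_kermxP.
  by rewrite -mulmxA mulmx_ker.
apply/row_subP => i; have := row_sub i (kermx C :&: K)%MS.
rewrite sub_capmx -TK sub_kermx => /andP[rC /submxP[u rE]].
by rewrite rE submxMr// sub_kermx mulmxA -rE.
Qed.

(** Psi reads components in the frame whose rows are those of Phi. *)
Lemma kermx_change_frame m n p (Phi Psi : 'M[F]_n) (C : 'M[F]_(n, p)) (A : 'M[F]_(m, n)) :
  Phi *m Psi = 1%:M -> (A :=: kermx C)%MS -> (A *m Psi :=: kermx (Phi *m C))%MS.
Proof.
move=> PP AC; have PP' := mulmx1C PP.
apply/eqmxP; apply/andP; split.
  rewrite sub_kermx mulmxA -(mulmxA A) PP' mulmx1 -sub_kermx; by rewrite AC.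
rewrite -[kermx _]mulmx1 -PP mulmxA submxMr// AC sub_kermx.
by rewrite -mulmxA mulmx_ker.
Qed.

End LinearAlgebra.

Section SymplecticComplement.
Variables (R : realType) (n : nat) (w : 'M[R]_n).
Hypothesis w_unit : w \in unitmx.

Lemma eqmx_sympl_orth p q (W : 'M[R]_(p, n)) (W' : 'M[R]_(q, n)) :
  (W :=: W')%MS -> (sympl_orth w W :=: sympl_orth w W')%MS.
Proof.
have sub p' q' (U : 'M[R]_(p', n)) (U' : 'M[R]_(q', n)) :
    (U <= U')%MS -> (sympl_orth w U' <= sympl_orth w U)%MS.
  move=> /submxP[D ->]; rewrite /sympl_orth sub_kermx trmx_mul !mulmxA.
  by rewrite -(mulmxA (kermx _)) mulmx_ker mul0mx.
by move=> WW; apply/eqmxP; rewrite !sub ?WW.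
Qed.

(** The form identifies the complement of Ker C with the annihilator of
    Ker C, that is with the image of the transpose of C. *)
Lemma sympl_orth_kermx p (C : 'M[R]_(n, p)) :
  (sympl_orth w (kermx C) :=: C^T *m invmx w)%MS.
Proof.
apply/eqmxP; apply/andP; split; last first.
  rewrite /sympl_orth sub_kermx -mulmxA (mulmxA (invmx w)) mulVmx// mul1mx.
  by rewrite -trmx_mul mulmx_ker trmx0.
rewrite -(mulmxK w_unit (sympl_orth _ _)) submxMr//.
rewrite -[X in (X <= _)%MS]trmxK; apply: submx_tr_kermx.
apply: trmx_inj; rewrite trmx0 trmx_mul trmxK -mulmxA.
exact: mulmx_ker.
Qed.

(** The rows of X span the tangent space of the orbit, C is the connection
    form, J the differential of the momentum map, T the differential of the
    projection to the quotient, and the rows of H span the complement of the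
    horizontal space Ker C. *)
Section Orbit.
Variables (k q : nat) (X : 'M[R]_(k, n)) (C J : 'M[R]_(n, k)) (T : 'M[R]_(n, q)).
Hypotheses (w_alt : w^T = - w) (XwJ : X *m w = J^T).
Hypotheses (XC : X *m C = 1%:M) (XJ : X *m J = 0).

Variables (H : 'M[R]_(k, n)) (HE : H = C^T *m invmx w).

(** Through the form, J is minus the transpose of X, and H is C^T, so that the
    product is minus the transpose of X C. *)
Lemma hor_orth_J : H *m J = - 1%:M.
Proof.
have -> : J = - (w *m X^T).
  by rewrite -[LHS]trmxK -XwJ trmx_mul w_alt mulNmx.
rewrite mulmxN HE -mulmxA (mulmxA (invmx w)) mulVmx// mul1mx -trmx_mul XC.
by rewrite trmx1.
Qed.

(** X is dual to C and kills J, while -H is dual to J; correcting -H by a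
    multiple of X makes it kill C. *)
Lemma connection_momentum_linv : exists L, L *m row_mx C J = 1%:M.
Proof.
exists (col_mx X (H *m C *m X - H)).
rewrite mul_col_row XC XJ !mulmxBl -!mulmxA XC XJ mulmx1 !mulmx0 subrr.
by rewrite hor_orth_J sub0r opprK -scalar_mx_block.
Qed.

Lemma kermx_momentum_split :
  (kermx J :=: X + (kermx C :&: kermx J))%MS /\ (X :&: (kermx C :&: kermx J) = 0)%MS.
Proof.
split.
  apply/eqmxP; apply/andP; split; last first.
    by rewrite addsmx_sub capmxSr andbT sub_kermx XJ.
  (* v C X is the part of v along the orbit. *)
  rewrite -[X in (X <= _)%MS](subrK (kermx J *m C *m X)) addrC addmx_sub_adds ?submxMl//.
  rewrite sub_capmx !sub_kermx; move: (kermx J) (mulmx_ker J) => K KJ.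
  by rewrite !mulmxBl -!mulmxA XC XJ KJ mulmx1 !mulmx0 !subrr eqxx.
apply/eqP; rewrite -submx0; apply/row_subP => i.
have := row_sub i (X :&: (kermx C :&: kermx J))%MS.
rewrite !sub_capmx => /and3P[/submxP[u ->] + _].
by rewrite sub_kermx -mulmxA XC mulmx1 => /eqP->; rewrite mul0mx sub0mx.
Qed.

Hypotheses (XT : X *m T = 0) (T_vert : (kermx T <= X)%MS) (T_full : row_full T).

(** The complement of Ker C /\ Ker J is the sum of the complements, and the
    complement of Ker J is spanned by the rows of X, which T kills. *)
Lemma orth_cap_proj :
  (sympl_orth w (kermx C :&: kermx J) *m T :=: sympl_orth w (kermx C) *m T)%MS.
Proof.
have E1 := eqmxMr T (eqmx_trans (eqmx_sympl_orth (cap_kermx C J))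
  (sympl_orth_kermx (row_mx C J))).
apply: eqmx_trans E1 _; apply: eqmx_trans (eqmx_sym (eqmxMr T (sympl_orth_kermx C))).
rewrite tr_row_mx -mulmxA mul_col_mx -XwJ -(mulmxA X) (mulmxA w) mulmxV// mul1mx XT.
rewrite mulmxA; apply: eqmx_trans (eqmx_sym (addsmxE _ _)) _.
exact: addsmx0.
Qed.

(** T^T w^-1 spans the complement of Ker T = X, and this is Ker J. *)
Lemma characteristic_proj :
  ((T^T *m (invmx w)^T *m T)^T :=: kermx J *m T)%MS.
Proof.
rewrite !trmx_mul !trmxK mulmxA; apply: eqmxMr.
apply: eqmx_trans (eqmx_sym (sympl_orth_kermx T)) _.
have TX : (kermx T :=: X)%MS by apply/eqmxP; rewrite T_vert sub_kermx XT/=.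
apply: eqmx_trans (eqmx_sympl_orth TX) _.
have -> : sympl_orth w X = kermx (- J).
  by rewrite -[J]trmxK -XwJ trmx_mul w_alt mulNmx opprK.
apply/eqmxP/andP; split; rewrite sub_kermx.
  by rewrite -oppr_eq0 -mulmxN mulmx_ker.
by rewrite mulmxN mulmx_ker oppr0.
Qed.

(** A combination of the rows of H killed by T is tangent to the orbit, hence
    killed by J; but H J = -1. *)
Lemma hor_orth_proj_free : row_free (H *m T).
Proof.
rewrite -kermx_eq0 -submx0; set K := kermx _.
have /(submx_trans) /(_ T_vert) : (K *m H <= kermx T)%MS.
  by rewrite sub_kermx -mulmxA mulmx_ker.
move=> /submxP[u E]; have : K *m H *m J = 0 by rewrite E -mulmxA XJ mulmx0.
rewrite -mulmxA hor_orth_J mulmxN mulmx1 => /eqP.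
by rewrite oppr_eq0 => /eqP->; rewrite sub0mx.
Qed.

(** Already before projecting, v = (v + v J H) - v J H splits every vector
    between Ker J and the rows of H. The sum stays direct under T because
    Ker T lies in Ker J. *)
Lemma momentum_hor_orth_split :
  (kermx J *m T + H *m T :=: (1%:M : 'M[R]_q))%MS /\
  ((kermx J *m T) :&: (H *m T) = 0)%MS.
Proof.
split.
  apply/eqmxP; apply/andP; split; first exact: submx1.
  have /row_fullP[S TE] := T_full.
  have -> : 1%:M = S *m (1%:M + J *m H) *m T + - (S *m J) *m (H *m T).
    rewrite mulmxDr mulmx1 mulmxDl TE mulNmx -addrA -[LHS]addr0; congr (_ + _).
    by rewrite !mulmxA subrr.
  apply: addmx_sub_adds; last exact: submxMl.
  rewrite submxMr// sub_kermx -mulmxA mulmxDl mul1mx -mulmxA hor_orth_J.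
  by rewrite mulmxN mulmx1 subrr mulmx0.
apply/eqP; rewrite -submx0; apply/row_subP => i.
have := row_sub i (kermx J *m T :&: (H *m T))%MS.
rewrite sub_capmx => /andP[/submxP[u uE] /submxP[v vE]].
have E : u *m (kermx J *m T) = v *m (H *m T) by rewrite -uE.
have /submxP[c cE] : (u *m kermx J - v *m H <= X)%MS.
  by apply: submx_trans T_vert; rewrite sub_kermx mulmxBl -(mulmxA v) -E mulmxA subrr.
have : (u *m kermx J - v *m H) *m J = 0 by rewrite cE -mulmxA XJ mulmx0.
rewrite mulmxBl -(mulmxA u) mulmx_ker mulmx0 sub0r -mulmxA hor_orth_J mulmxN opprK.
by rewrite mulmx1 vE => ->; rewrite mul0mx sub0mx.
Qed.

End Orbit.
End SymplecticComplement.

(** * Smooth frames of distributions *)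

Section Distributions.
Variables (R : realType) (m : nat) (M : manifold R m).

(** Composing with a right inverse of F x reduces this to the continuity of a
    determinant. *)
Lemma row_free_near r (F : M -> 'M[R]_(r, m)) x :
  vsmooth_at F x -> row_free (F x) -> \forall y \near x, row_free (F y).
Proof.
move=> FS /row_freeP[B FB].
have dS : vsmooth_at (fun y => \det (F y *m B) : R^o) x.
  move=> a aA ax; apply: smooth_at_det.
  exact: smooth_at_mulmx (FS a aA ax) (smooth_at_cst _ B).
have d1 : \det (F x *m B) != 0 by rewrite FB det1 oner_neq0.
have : \forall y \near x, \det (F y *m B) != 0.
  have d1' : nbhs (\det (F x *m B) : R) [set r | r != 0].
    by apply: open_nbhs_nbhs; split=> //; exact: open_neq.
  exact: (vsmooth_at_continuous dS d1').
apply: filterS => y; rewrite -unitfE -[_ \is a _]/(_ \in unitmx) => u.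
by apply/row_freeP; exists (B *m invmx (F y *m B)); rewrite mulmxA mulmxV.
Qed.

(** The frame may be given on the manifold rather than in the chosen chart, and
    only near the point. *)
Lemma distribution_of_frames (A : M -> 'M[R]_m) :
  (forall x, exists r, exists F : M -> 'M[R]_(r, m),
    vsmooth_at F x /\ \forall y \near x,
      row_free (F y) /\ (A y *m vdiff (chart_at x) y :=: F y)%MS) ->
  Defs.distribution A.
Proof.
move=> AF x; have [r [F [FS Fx]]] := AF x; set a := chart_at x.
have ax : chart_dom a x by exact: chart_at_dom.
have aA : atlas a by exact: chart_at_atlas.
have [U [oU Ux US]] := FS a aA ax.
have := near_chart_inv ax Fx; rewrite -[\forall p \near _, _]/(nbhs _ _) nbhsE.
move=> [V [oV Vx] VF].
have oW : open (U `&` V `&` (a @` chart_dom a)).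
  by apply: openI; [exact: openI|exact: chart_codom_open].
exists r, (U `&` V `&` (a @` chart_dom a)), (F \o chart_inv a); split.
- by split=> //; exists x.
- by move=> p [].
- split=> // s; apply: times_differentiable_on_sub (US s).
  by move=> p [[]].
- by move=> p [[_ Vp] _]; rewrite coord_compE; exact: VF.
Qed.

(** With L a left inverse of C at x and B0 a basis of the kernel there,
    B0 - B0 C (L C)^-1 L is a frame of the kernel near x; multiplying by the
    determinant of L C makes it polynomial in C. *)
Lemma kernel_distribution r (C : M -> 'M[R]_(m, r)) (A : M -> 'M[R]_m) :
  (forall x, vsmooth_at (fun y => frame (chart_at x) y *m C y) x) ->
  (forall x, exists L, L *m C x = 1%:M) ->
  (forall x, A x :=: kermx (C x))%MS -> Defs.distribution A.
Proof.
move=> CS CL AC; apply: distribution_of_frames => x; set a := chart_at x.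
have ax : chart_dom a x by exact: chart_at_dom.
have aA : atlas a by exact: chart_at_atlas.
pose Ca y := frame a y *m C y.
have CaS : vsmooth_at Ca x := CS x.
have CaL y : chart_dom a y -> exists L, L *m Ca y = 1%:M.
  move=> ay; have [L LC] := CL y; exists (L *m vdiff a y).
  by rewrite mulmxA -(mulmxA L) vdiff_chart_frame// mulmx1.
have [L LC] := CaL x ax; pose B0 := row_base (kermx (Ca x)).
pose F y := \det (L *m Ca y) *: B0 - B0 *m Ca y *m \adj (L *m Ca y) *m L.
have B0C : B0 *m Ca x = 0.
  by apply/sub_kermxP; rewrite eq_row_base.
have LCS : vsmooth_at (fun y => L *m Ca y) x.
  exact (vsmooth_at_mulmx (@vsmooth_at_cst _ _ _ _ L x) CaS).
have FS : vsmooth_at F x.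
  move=> b bA bx; have [LCb Cb] := (LCS b bA bx, CaS b bA bx).
  have -> : F \o chart_inv b = (fun p => (\det (L *m Ca (chart_inv b p)))%:M *m B0
      + (- B0) *m Ca (chart_inv b p) *m \adj (L *m Ca (chart_inv b p)) *m L).
    by apply/funext => p; rewrite /F /= mul_scalar_mx !mulNmx.
  have cS n p (c : 'M[R]_(n, p)) := smooth_at_cst (b x) c.
  apply: smooth_atD.
    apply: smooth_at_mulmx; last exact: cS.
    exact: smooth_at_scalar_mx (smooth_at_det LCb).
  apply: smooth_at_mulmx; last exact: cS.
  apply: smooth_at_mulmx; last exact: (smooth_at_adj LCb).
  by apply: smooth_at_mulmx; [exact: cS|exact: Cb].
exists (\rank (kermx (Ca x))), F; split=> //.
have Fx : row_free (F x).
  rewrite /F LC B0C !mul0mx subr0 det1 scale1r.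
  exact: row_base_free.
apply: filterS2 (row_free_near FS Fx) (chart_dom_near ax) => y Fy ay; split=> //.
have ACa := kermx_change_frame (frame_vdiff_chart aA ay) (AC y).
(* Near x the frame F lies in the kernel and has the same rank. *)
apply: eqmx_trans ACa _; apply: eqmx_sym; apply/eqmxP; rewrite -(geq_leqif (mxrank_leqif_eq _)).
  rewrite mxrank_ker (eqP (Fy : \rank (F y) == _)) mxrank_ker leq_sub2l//.
  have rC z : chart_dom a z -> \rank (Ca z) = r.
    move=> /CaL[L' L'C]; apply/eqP; apply/row_fullP; by exists L'.
  by rewrite !rC.
rewrite sub_kermx /F mulmxBl -scalemxAl.
rewrite -(mulmxA _ L) -(mulmxA (B0 *m Ca y)) mul_adj_mx mul_mx_scalar.
by rewrite subrr.
Qed.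

End Distributions.

(** * One-forms and two-forms in coordinates *)

Section Forms.
Variables (R : realType) (m : nat) (M : manifold R m).

Lemma smooth_one_form_at d (A : M -> 'M[R]_(m, d)) a x :
  smooth_one_form A -> atlas a -> chart_dom a x ->
  vsmooth_at (fun y => frame a y *m A y) x.
Proof.
move=> AS aA ax; apply: (vsmooth_at_chart aA ax).
rewrite [X in smooth_at _ X](_ : _ = fun p =>
    let y := chart_inv a p in coord_frame a y *m A y); last first.
  by apply/funext => p; rewrite /= coord_frameE.
by apply: smooth_on_at (AS a aA) _; exists x.
Qed.

Lemma smooth_one_form_of d (A : M -> 'M[R]_(m, d)) :
  (forall a x, atlas a -> chart_dom a x -> vsmooth_at (fun y => frame a y *m A y) x) ->
  smooth_one_form A.
Proof.
move=> AS a aA; apply: smooth_at_on => [|_ [x ax <-]]; first exact: chart_codom_open.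
rewrite [X in smooth_at _ X](_ : _ = (fun y => frame a y *m A y) \o chart_inv a).
  exact: AS.
by apply/funext => p; rewrite /= coord_frameE.
Qed.

Lemma coord_form_at (w : M -> 'M[R]_m) a x :
  symplectic_form w -> atlas a -> chart_dom a x ->
  vsmooth_at (fun y => frame a y *m w y *m (frame a y)^T) x.
Proof.
move=> [_ _ wS _] aA ax; apply: (vsmooth_at_chart aA ax).
rewrite [X in smooth_at _ X](_ : _ = coord_form w a); last first.
  by apply/funext => p; rewrite /coord_form /= coord_frameE.
by apply: smooth_on_at (wS a aA) _; exists x.
Qed.

End Forms.

(** A chart b around f z factors tang f *m A into the differential of b \o f
    and the components of A in b, which are smooth separately. *)
Lemma smooth_one_form_pullback (R : realType) m n d (M : manifold R m)
    (N : manifold R n) (f : N -> M)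
    (A : M -> 'M[R]_(m, d)) :
  smooth_map f -> smooth_one_form A ->
  smooth_one_form (fun z => tang f z *m A (f z)).
Proof.
move=> fS AS; apply: smooth_one_form_of => c z cA cz.
have fSz := smooth_map_at z fS.
have bA := chart_at_atlas (f z); have bz := chart_at_dom (f z).
set b := chart_at (f z) in bA bz *.
have bfS : vsmooth_at (b \o f) z := fSz.2 b bA bz.
have H := vsmooth_at_mulmx (vsmooth_frame_vdiff cA cz bfS)
  (vsmooth_at_pull fSz (smooth_one_form_at AS bA bz)).
apply: vsmooth_at_eq H; have := msmooth_at_near fSz (chart_dom_near bz).
apply: filterS => y /= byd.
rewrite (vdiff_pull (smooth_map_at y fS) (chart_vsmooth_at bA byd)).
rewrite -!mulmxA; congr (_ *m (_ *m _)).
by rewrite mulmxA vdiff_chart_frame// mul1mx.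
Qed.

Lemma bilinear_mx_inj (R : nzRingType) m n (A B : 'M[R]_(m, n)) :
  (forall (u : 'rV_m) (v : 'rV_n), (u *m A *m v^T) 0 0 = (u *m B *m v^T) 0 0) -> A = B.
Proof.
move=> AB; apply/matrixP => i j; have := AB (delta_mx 0 i) (delta_mx 0 j).
by rewrite -!rowE trmx_delta -!colE !mxE.
Qed.

(** C^T w^-1 can be computed from the components of C and w in any frame. *)
Lemma change_frame_hor_orth (R : comUnitRingType) n k (Phi w : 'M[R]_n) (C : 'M[R]_(n, k)) :
  Phi \in unitmx -> w \in unitmx ->
  (Phi *m C)^T *m invmx (Phi *m w *m Phi^T) *m Phi = C^T *m invmx w.
Proof.
move=> uP uw; have uPT : Phi^T \in unitmx by rewrite unitmx_tr.
set W := Phi *m w *m Phi^T; have uW : W \in unitmx by rewrite !unitmx_mul uP uw.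
apply: (canRL (mulmxK uw)); apply: (can_inj (mulmxK uPT)).
rewrite -(mulmxA _ Phi) -(mulmxA _ (Phi *m w)) -/W.
by rewrite mulmxKV// trmx_mul.
Qed.

(** * Hamiltonian actions of Abelian groups *)

Section AbelianHamiltonian.
Variables (R : realType) (n k q : nat) (P : manifold R n) (w : P -> 'M[R]_n).
Variables (G : lie_group R k) (a : lie_action G P) (J : P -> 'rV[R]_k).
Variables (Q : manifold R q) (pi : P -> Q) (conn : P -> 'M[R]_(n, k)).
Hypotheses (w_symplectic : symplectic_form w) (G_abelian : commutative (@lgmul R k G)).
Hypotheses (a_hamiltonian : hamiltonian_action a w J).
Hypotheses (pi_bundle : principal_bundle a pi) (conn_principal : principal_connection a conn).

Lemma sympl_unit x : w x \in unitmx.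
Proof. by case: w_symplectic. Qed.

Lemma sympl_alt x : (w x)^T = - w x.
Proof. by case: w_symplectic. Qed.

Lemma momentum_smooth x : vsmooth_at J x.
Proof. by case: a_hamiltonian => _ JS _ _; exact: smooth_fun_at. Qed.

Lemma momentum_act g x : J (a g x) = J x.
Proof. by case: a_hamiltonian => _ _ -> _; rewrite coAd_abelian. Qed.

Lemma gen_momentum x : gen a x *m vdiff J x = 0.
Proof. apply: infgen_vdiff => [|g]; [exact: momentum_smooth|exact: momentum_act]. Qed.

Lemma gen_sympl x : gen a x *m w x = (vdiff J x)^T.
Proof.
case: a_hamiltonian => _ _ _ H; apply: bilinear_mx_inj => u v.
have := H x u v; rewrite /Defs.form /pairing infgenE differentialE => E.
rewrite mulmxA E.
have -> : u *m (vdiff J x)^T *m v^T = (v *m vdiff J x *m u^T)^T.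
  by rewrite !trmx_mul trmxK mulmxA.
by rewrite [RHS]mxE.
Qed.

Lemma gen_conn x : gen a x *m conn x = 1%:M.
Proof.
case: conn_principal => _ _ cX; apply/row_matrixP => i.
by rewrite !rowE mulmx1 mulmxA -infgenE cX.
Qed.

Lemma act_conn g x : tang (a g) x *m conn (a g x) = conn x.
Proof.
case: conn_principal => _ cg _; apply/row_matrixP => i.
have := cg g x (delta_mx 0 i); rewrite Ad_abelian// mulmx1 tmapE => E.
by rewrite !rowE mulmxA.
Qed.

Lemma act_momentum g x : tang (a g) x *m vdiff J (a g x) = vdiff J x.
Proof.
rewrite -vdiff_pull; [|exact: msmooth_act|exact: momentum_smooth].
by congr (vdiff _ _); apply/funext => y; rewrite /= momentum_act.
Qed.

Lemma act_sympl g x : tang (a g) x *m w (a g x) *m (tang (a g) x)^T = w x.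
Proof.
case: a_hamiltonian => H _ _ _; apply: bilinear_mx_inj => u v.
by have := H g x u v; rewrite /Defs.form !tmapE trmx_mul !mulmxA.
Qed.

Lemma conn_smooth b x : atlas b -> chart_dom b x ->
  vsmooth_at (fun y => frame b y *m conn y) x.
Proof. by case: conn_principal => cS _ _; exact: smooth_one_form_at. Qed.

Definition recon x : 'M[R]_n := (kermx (conn x) :&: kermx (vdiff J x))%MS.

Lemma recon_act g x : (recon x *m tang (a g) x :=: recon (a g x))%MS.
Proof.
have Tu := tang_act_unit a g x; set T := tang (a g) x in Tu *.
apply: eqmx_trans (eqmxMr T (cap_kermx _ _)) _.
apply: eqmx_trans _ (eqmx_sym (cap_kermx _ _)).
have -> : row_mx (conn x) (vdiff J x) = T *m row_mx (conn (a g x)) (vdiff J (a g x)).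
  by rewrite mul_mx_row act_conn act_momentum.
apply: eqmx_trans (kermx_change_frame (mulVmx Tu) (eqmx_refl _)) _.
by rewrite mulKmx.
Qed.

Lemma recon_distribution : Defs.distribution recon.
Proof.
apply: (@kernel_distribution _ _ _ _ (fun x => row_mx (conn x) (vdiff J x))) => x.
- have [aA ax] := (chart_at_atlas x, chart_at_dom x).
  have := vsmooth_at_row_mx (conn_smooth aA ax)
    (vsmooth_frame_vdiff aA ax (@momentum_smooth x)).
  by apply: vsmooth_at_eq; apply: nearW => y; rewrite mul_mx_row.
- exact (connection_momentum_linv (sympl_unit x) (sympl_alt x) (gen_sympl x)
    (gen_conn x) (gen_momentum x) erefl).
- exact: cap_kermx.
Qed.

(** By [sympl_orth_kermx], a basis of the image in the quotient of the
    symplectic complement of the horizontal space. *)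
Definition hat x : 'M[R]_(k, q) := (conn x)^T *m invmx (w x) *m tang pi x.

Lemma hat_hor x : (hat x :=: sympl_orth (w x) (kermx (conn x)) *m tang pi x)%MS.
Proof. exact/eqmxMr/eqmx_sym/sympl_orth_kermx/sympl_unit. Qed.

Lemma hat_recon x : (hat x :=: sympl_orth (w x) (recon x) *m tang pi x)%MS.
Proof.
apply: eqmx_trans (hat_hor x) _; apply: eqmx_sym.
exact (orth_cap_proj (sympl_unit x) _ (gen_sympl x) (bundle_infgen pi_bundle x)).
Qed.

(** Translation by g is a change of frame which carries conn, w and pi at
    a g x to the same data at x. *)
Lemma hat_act g x : hat (a g x) = hat x.
Proof.
rewrite /hat (bundle_tang_act pi_bundle g x) mulmxA; congr (_ *m _).
rewrite -(act_sympl g x) -(act_conn g x) change_frame_hor_orth ?sympl_unit//.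
exact: tang_act_unit.
Qed.

Lemma hat_fibre x x' : pi x = pi x' -> hat x = hat x'.
Proof. by case: pi_bundle => _ _ _ piE _ /piE[g ->]; rewrite hat_act. Qed.

Lemma hat_free x : row_free (hat x).
Proof.
exact (hor_orth_proj_free (sympl_unit x) (sympl_alt x) (gen_sympl x)
  (gen_conn x) (gen_momentum x) erefl (bundle_vertical pi_bundle x G_abelian)).
Qed.

(** A local section of the bundle moves the frame [hat] to the quotient. In
    coordinates the adjugate, a polynomial, replaces the inverse of the form;
    this only rescales the frame. *)
Lemma hat_distribution (D : Q -> 'M[R]_q) :
  (forall x, D (pi x) :=: hat x)%MS -> Defs.distribution D.
Proof.
move=> DE; apply: distribution_of_frames => y; set c := chart_at y.
have cA : atlas c by exact: chart_at_atlas.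
have cy : chart_dom c y by exact: chart_at_dom.
case: pi_bundle => _ _ _ _ /(_ y)[V [s [_ [Vy sS _ sV _]]]].
have sSy := smooth_map_on_at sS Vy; set b := chart_at (s y).
have bA : atlas b by exact: chart_at_atlas.
have bs : chart_dom b (s y) by exact: chart_at_dom.
have cpS z : chart_dom c (pi z) -> vsmooth_at (c \o pi) z.
  by move=> cz; exact: (bundle_smooth pi_bundle z).2.
pose wb x := frame b x *m w x *m (frame b x)^T.
pose F x := (frame b x *m conn x)^T *m \adj (wb x) *m (frame b x *m vdiff (c \o pi) x).
have FS : vsmooth_at F (s y).
  apply: vsmooth_at_mulmx.
    apply: vsmooth_at_mulmx; first exact: vsmooth_at_trmx (conn_smooth bA bs).
    exact: vsmooth_at_adj (coord_form_at w_symplectic bA bs).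
  by apply: vsmooth_frame_vdiff => //; apply: cpS; rewrite sV.
have [oV _ _] := sS.
exists k, (F \o s); split; first exact: vsmooth_at_pull sSy FS.
apply: filterS3 (open_nbhs_nbhs (conj oV Vy)) (chart_dom_near cy)
  (msmooth_at_near sSy (chart_dom_near bs)) => z Vz cz bz.
have fu : frame b (s z) \in unitmx by case/mulmx1_unit: (frame_vdiff_chart bA bz).
have cu : vdiff c z \in unitmx by case/mulmx1_unit: (frame_vdiff_chart cA cz).
have wu : wb (s z) \in unitmx by rewrite !unitmx_mul unitmx_tr fu sympl_unit.
have du : \det (wb (s z)) != 0 by rewrite -unitfE.
have FE : F (s z) = \det (wb (s z)) *: (hat (s z) *m vdiff c z).
  have adjE : \adj (wb (s z)) = \det (wb (s z)) *: invmx (wb (s z)).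
    by rewrite /invmx wu scalerA divff// scale1r.
  have -> : vdiff c z = vdiff c (pi (s z)) by rewrite sV.
  have cpz : chart_dom c (pi (s z)) by rewrite sV.
  rewrite /F adjE -scalemxAr -scalemxAl; congr (_ *: _).
  rewrite (vdiff_pull (bundle_smooth pi_bundle (s z)) (chart_vsmooth_at cA cpz)).
  rewrite !mulmxA change_frame_hor_orth ?sympl_unit//.
have EF : (D z *m vdiff c z :=: F (s z))%MS.
  rewrite FE; apply: eqmx_sym; apply: eqmx_trans (eqmx_scale _ du) _.
  by apply: eqmxMr; apply: eqmx_sym; rewrite -[z in D z](sV z Vz); exact: DE.
split=> //; rewrite /row_free /= FE (eqmx_scale _ du) mxrankMfree.
  exact: hat_free.
by rewrite row_free_unit.
Qed.

End AbelianHamiltonian.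

(** * Marsden-Weinstein bundles *)

Section LevelSets.
Variables (R : realType) (n k d r : nat) (P : manifold R n) (G : lie_group R k).
Variables (a : lie_action G P) (J : P -> 'rV[R]_k) (conn : P -> 'M[R]_(n, k)).
Variables (mu : 'rV[R]_k) (N : manifold R d) (iota : N -> P) (aN : lie_action G N).
Variables (B : manifold R r) (rho : N -> B).
Hypotheses (N_level : level_set_bundle a J mu iota aN rho).

Let iota_smooth : smooth_map iota.
Proof. by case: N_level => -[]. Qed.

Let iota_act g z : iota (aN g z) = a g (iota z).
Proof. by case: N_level. Qed.

Lemma pullback_principal_connection : principal_connection a conn ->
  principal_connection aN (fun z => tang iota z *m conn (iota z)).
Proof.
move=> [cS cg cX]; split; first exact: smooth_one_form_pullback.
  move=> g z v; rewrite tmapE iota_act mulmxA -(mulmxA v).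
  rewrite -tang_comp; [|exact: msmooth_act|exact: smooth_map_at].
  rewrite [X in tang X z](_ : _ = a g \o iota); last first.
    by apply/funext => y; rewrite /= iota_act.
  rewrite tang_comp; [|exact: smooth_map_at|exact: msmooth_act].
  by rewrite !mulmxA -(tmapE (a g)) cg.
move=> z xi; rewrite infgenE -mulmxA (mulmxA (gen aN z)).
rewrite (infgen_tang (smooth_map_at z iota_smooth) (iota_act^~ z)).
by rewrite mulmxA -infgenE cX.
Qed.

(** One inclusion holds because J is constant on the level set; equality
    follows by counting dimensions, J having rank k at a regular point. *)
Lemma level_set_tangent z : d = (n - k)%N ->
  (forall x, vsmooth_at J x) -> regular_value J mu ->
  (tang iota z :=: kermx (vdiff J (iota z)))%MS.
Proof.
move=> dE JS Jmu; case: (N_level) => -[_ _ free _] rangeE _ _.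
have Jiota y : J (iota y) = mu.
  have : range iota (iota y) by exists y.
  by rewrite rangeE.
apply/eqmxP; rewrite -(geq_leqif (mxrank_leqif_eq _)).
  have := free z; rewrite /row_free tmapE => /eqP->.
  have := Jmu _ (Jiota z); rewrite /row_full differentialE => /eqP rJ.
  by rewrite mxrank_ker rJ dE.
rewrite sub_kermx -vdiff_pull; [|exact: smooth_map_at|exact: JS].
rewrite [X in vdiff X](_ : _ = fun _ => mu) ?vdiff_cst//.
by apply/funext => y; exact: Jiota.
Qed.

End LevelSets.

(** * Reconstruction connections from principal connections *)

Unset Implicit Arguments.

Theorem theorem3p1 (R : realType) (n k q : nat)
    (P : manifold R n) (w : P -> 'M[R]_n)
    (G : lie_group R k) (a : lie_action G P) (J : P -> 'rV[R]_k)
    (Q : manifold R q) (pi : P -> Q) (b : Q -> 'M[R]_q)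
    (conn : P -> 'M[R]_(n, k))
    (w_symplectic : symplectic_form w)
    (G_abelian : commutative (@lgmul R k G))
    (a_free : free_action a) (a_proper : proper_action a)
    (a_hamiltonian : hamiltonian_action a w J)
    (pi_bundle : principal_bundle a pi)
    (b_quotient : quotient_poisson w pi b)
    (conn_principal : principal_connection a conn) :
  let hor := fun x => kermx (conn x) in
  let A := fun x => (hor x :&: kermx (differential J x))%MS in
  [/\ forall mu, range J mu -> regular_value J mu ->
        stabilizer G mu = setT /\
        forall (r : nat) (N : manifold R (n - k)) (iota : N -> P)
               (aN : lie_action G N) (B : manifold R r) (rho : N -> B),
          level_set_bundle a J mu iota aN rho ->
          exists alpha : N -> 'M[R]_(n - k, k),
            [/\ principal_connection aN alpha,
                forall z, alpha z = tmap iota z *m conn (iota z) &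
                forall z, (kermx (alpha z) *m tmap iota z :=: A (iota z))%MS],
      reconstruction_connection a J A &
      exists D : Q -> 'M[R]_q,
        [/\ stratification_connection b D, is_hat w pi A D, is_hat w pi hor D &
            forall (y : Q) (x : P), pi x = y ->
              (sympl_orth (w x) (A x) *m tmap pi x
                 :=: sympl_orth (w x) (hor x) *m tmap pi x)%MS]].
Proof.
move=> hor A.
have AE x : A x = recon J conn x by rewrite /A /recon differentialE.
have JS : forall x, vsmooth_at J x := momentum_smooth a_hamiltonian.
split.
- move=> mu _ mu_reg; split; first by apply/seteqP; split=> // g _; exact: coAd_abelian.
  move=> r N iota aN B rho N_level.
  exists (fun z => tmap iota z *m conn (iota z)).
  rewrite [X in principal_connection _ X](_ : _ = fun z => tang iota z *m conn (iota z));
    last by apply/funext => z; rewrite tmapE.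
  split=> // [|z]; first exact: pullback_principal_connection N_level conn_principal.
  rewrite AE tmapE; apply: kermx_mul_eqmx.
  exact (level_set_tangent N_level z erefl JS mu_reg).
- split.
    rewrite [A](_ : _ = recon J conn); last by apply/funext.
    split; first exact: (recon_distribution w_symplectic G_abelian a_hamiltonian conn_principal).
    move=> g x; rewrite tmapE.
    exact: (recon_act G_abelian a_hamiltonian conn_principal).
  move=> x; rewrite AE differentialE infgenE.
  have [kE k0] := kermx_momentum_split (gen_conn conn_principal x)
    (gen_momentum G_abelian a_hamiltonian x).
  have oE : (stabilizer_algebra G (J x) *m gen a x :=: gen a x)%MS.
    apply: eqmx_trans (eqmxMr _ (stabilizer_algebra_abelian G_abelian (J x))) _.
    by rewrite mul1mx.
  split; first by apply: eqmx_trans kE _; apply: adds_eqmx => //; exact: eqmx_sym.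
  by apply: eqmx_trans (cap_eqmx oE (eqmx_refl _)) _; rewrite k0.
have pi_surj y : exists x, pi x = y by case: pi_bundle.
(* [hat] is constant on the fibres of pi, so any choice of x over y will do. *)
pose sel y := projT1 (cid (pi_surj y)).
have piK y : pi (sel y) = y by rewrite /sel; case: cid.
pose D y := <<hat w pi conn (sel y)>>%MS.
have DE y x : pi x = y -> (D y :=: hat w pi conn x)%MS.
  move=> xy; apply: eqmx_trans (genmxE _) _.
  have sx : pi (sel y) = pi x by rewrite piK.
  by rewrite (hat_fibre w_symplectic G_abelian a_hamiltonian pi_bundle conn_principal sx).
have DA y x : pi x = y -> (D y :=: sympl_orth (w x) (A x) *m tang pi x)%MS.
  move=> xy; rewrite AE; apply: eqmx_trans (DE y x xy) _.
  exact: (hat_recon conn w_symplectic a_hamiltonian pi_bundle x).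
have Dhor y x : pi x = y -> (D y :=: sympl_orth (w x) (hor x) *m tang pi x)%MS.
  move=> xy; apply: eqmx_trans (DE y x xy) _; exact: (hat_hor pi conn w_symplectic x).
exists D; split.
- split.
    apply: (hat_distribution w_symplectic G_abelian a_hamiltonian pi_bundle conn_principal).
    by move=> x; exact: DE.
  move=> y; have [x xy] := pi_surj y.
  have [E1 E2] := momentum_hor_orth_split (sympl_unit w_symplectic x)
    (sympl_alt w_symplectic x) (gen_sympl a_hamiltonian x) (gen_conn conn_principal x)
    (gen_momentum G_abelian a_hamiltonian x) erefl
    (bundle_vertical pi_bundle x G_abelian) (bundle_submersion pi_bundle x).
  have bE : (characteristic b y :=: kermx (vdiff J x) *m tang pi x)%MS.
    rewrite /characteristic -xy b_quotient /symplectic_bivector !tmapE.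
    exact (characteristic_proj (sympl_unit w_symplectic x) (sympl_alt w_symplectic x)
      (gen_sympl a_hamiltonian x) (bundle_infgen pi_bundle x)
      (bundle_vertical pi_bundle x G_abelian)).
  split; first exact: eqmx_trans (adds_eqmx bE (DE y x xy)) E1.
  by apply: eqmx_trans (cap_eqmx bE (DE y x xy)) _; rewrite E2.
- by move=> y x xy; rewrite tmapE; exact: DA.
- by move=> y x xy; rewrite tmapE; exact: Dhor.
- move=> y x xy; rewrite tmapE.
  exact: eqmx_trans (eqmx_sym (DA y x xy)) (Dhor y x xy).
Qed.
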